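(* Let $k\ge 1$ and let $T_i\in \mathrm{SL}(2,\mathbb{Z})$, $i=1,\ldots,k$. The transformations $T_1,\ldots,T_k$ are jointly mixing if and only if each $T_i$ is hyperbolic, $T_i\neq \pm T_j$ for $i\neq j$, and for every $\rho>1$ there are at most two matrices among $T_i$, $i=1,\ldots,k$ (at most two indices $i$), having an eigenvalue $\lambda$ such that $|\lambda|=\rho$.
   Context: $\mathbb{T}^2=\mathbb{R}^2/\mathbb{Z}^2$ is the 2-dimensional torus with normalized Haar (Lebesgue) measure $d\xi$; $\mathrm{SL}(2,\mathbb{Z})$ acts on $\mathbb{T}^2$ by automorphisms $\xi\mapsto T\xi$. A matrix is hyperbolic if all its eigenvalues have absolute value different from $1$. Sequences $T_{1,n},\ldots,T_{k,n}\in\mathrm{SL}(2,\mathbb{Z})$, $n\ge 1$, are jointly mixing if for all $f_1,\ldots,f_{k+1}\in L^\infty(\mathbb{T}^2)$, $$\int_{\mathbb{T}^2} f_1(T_{1,n}\xi)\cdots f_k(T_{k,n}\xi)f_{k+1}(\xi)\,d\xi\to \prod_{i=1}^{k+1}\int_{\mathbb{T}^2}f_i(\xi)\,d\xi\quad\text{as } n\to\infty.$$ Transformations $T_1,\ldots,T_k\in\mathrm{SL}(2,\mathbb{Z})$ are jointly mixing if the sequences $T_1^n,\ldots,T_k^n$, $n\ge 1$, are jointly mixing. *)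

(* Defs.v *)
From HB Require Import structures.
From mathcomp Require Import all_boot all_order all_algebra.
From mathcomp Require Import complex.
From mathcomp Require Import all_classical all_reals all_analysis.

Set Implicit Arguments.
Unset Strict Implicit.
Unset Printing Implicit Defensive.

Import Order.TTheory GRing.Theory Num.Theory.
Import numFieldNormedType.Exports.

Local Open Scope classical_set_scope.
Local Open Scope quotient_scope.
Local Open Scope ring_scope.

Definition int_lattice (R : realType) : {pred R * R} :=
  fun v => (v.1 \is a Num.int) && (v.2 \is a Num.int).

Lemma int_lattice_zmod_closed (R : realType) : zmod_closed (@int_lattice R).
Proof.
split=> [|u v]; first by apply/andP; split; exact: rpred0.
by move=> /andP[u1 u2] /andP[v1 v2]; apply/andP; split; exact: rpredB.
Qed.

HB.instance Definition _ (R : realType) :=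
  GRing.isZmodClosed.Build (R * R)%type (@int_lattice R)
    (@int_lattice_zmod_closed R).

Definition torus (R : realType) := Quotient.quot (@int_lattice R).

HB.instance Definition _ (R : realType) := GRing.Zmodule.on (torus R).
HB.instance Definition _ (R : realType) :=
  EqQuotient.copy (torus R) (Quotient.quot (@int_lattice R)).
HB.instance Definition _ (R : realType) := isPointed.Build (torus R) 0.

Section torus_measurable.
Variable R : realType.

(* The quotient sigma-algebra: the Borel sets of the torus are the sets whose
   preimage in the plane is Borel. *)
Definition torus_measurable : set (set (torus R)) :=
  image_set_system setT (\pi_(torus R))
    (@measurable _ (measurableTypeR R * measurableTypeR R)%type).

Let torus_sigma : sigma_algebra setT torus_measurable.
Proof. by apply: sigma_algebra_image; exact: sigma_algebra_measurable. Qed.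

Let torus_measurable0 : torus_measurable set0.
Proof. by case: torus_sigma. Qed.

Let torus_measurableC A : torus_measurable A -> torus_measurable (~` A).
Proof. by case: torus_sigma => _ + _ mA => /(_ _ mA); rewrite setTD. Qed.

Let torus_measurable_bigcup (F : (set (torus R))^nat) :
  (forall i, torus_measurable (F i)) -> torus_measurable (\bigcup_i F i).
Proof. by case: torus_sigma => _ _; exact. Qed.

HB.instance Definition _ := @isMeasurable.Build default_measure_display
  (torus R) torus_measurable torus_measurable0 torus_measurableC
  torus_measurable_bigcup.

Lemma measurable_pi_torus :
  measurable_fun [set: measurableTypeR R * measurableTypeR R] (\pi_(torus R)).
Proof. by move=> _ A mA. Qed.

End torus_measurable.

Section torus_measure.
Variable R : realType.
Local Open Scope ereal_scope.

Definition unit_square : set (measurableTypeR R * measurableTypeR R) :=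
  `[0%R, 1%R[%classic `*` `[0%R, 1%R[%classic.

Lemma measurable_unit_square : measurable unit_square.
Proof. by apply: measurableX; exact: measurable_itv. Qed.

(* The unit square is a fundamental domain for the lattice of integer points,
   so this is the image of Lebesgue measure on the torus. *)
Definition haar_torus : set (torus R) -> \bar R :=
  pushforward
    (mrestr (@lebesgue_measure R \x @lebesgue_measure R)
       measurable_unit_square)
    (\pi_(torus R)).

Let haar0 : haar_torus set0 = 0.
Proof. by rewrite /haar_torus/pushforward preimage_set0 measure0. Qed.

Let haar_ge0 A : 0 <= haar_torus A.
Proof. exact: measure_ge0. Qed.

Let haar_sigma_additive : semi_sigma_additive haar_torus.
Proof.
have := @measure_semi_sigma_additive _ _ _
  (measure_function_pushforward__canonical__measure_function_Measure
     (mrestr (@lebesgue_measure R \x @lebesgue_measure R)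
       measurable_unit_square)
     (@measurable_pi_torus R)).
exact.
Qed.

HB.instance Definition _ := isMeasure.Build _ _ _ haar_torus
  haar0 haar_ge0 haar_sigma_additive.

Let haar_setT : haar_torus setT = 1.
Proof.
rewrite /haar_torus /pushforward preimage_setT /mrestr setTI.
have leb01 : @lebesgue_measure R `[0%R, 1%R[%classic = 1.
  by rewrite lebesgue_measure_itv /= lte_fin ltr01 oppr0 adde0.
rewrite product_measure1E; [|exact: measurable_itv..].
by rewrite -[RHS]mule1; congr (_ * _).
Qed.

HB.instance Definition _ := Measure_isProbability.Build _ _ _
  haar_torus haar_setT.

End torus_measure.

Definition plane_act (R : realType) (T : 'M[int]_2) (v : R * R) : R * R :=
  ((T 0 0)%:~R * v.1 + (T 0 1)%:~R * v.2,
   (T 1 0)%:~R * v.1 + (T 1 1)%:~R * v.2).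

Definition torus_act (R : realType) (T : 'M[int]_2) (xi : torus R) : torus R :=
  \pi_(torus R) (plane_act T (repr xi)).

Lemma torus_act_pi (R : realType) (T : 'M[int]_2) (v : R * R) :
  torus_act T (\pi_(torus R) v) = \pi_(torus R) (plane_act T v).
Proof.
have /eqP : repr (\pi_(torus R) v) = v %[mod torus R] by rewrite reprK.
rewrite -Quotient.idealrBE => /andP[/= w1 w2].
apply/eqP; rewrite -Quotient.idealrBE /plane_act; apply/andP => /=.
set w := repr _ in w1 w2 *.
by split; rewrite opprD addrACA -!mulrBr rpredD// rpredM// intr_int.
Qed.

Lemma plane_actM (R : realType) (S T : 'M[int]_2) (v : R * R) :
  plane_act (S *m T) v = plane_act S (plane_act T v).
Proof.
rewrite /plane_act !mxE !big_ord_recl !big_ord0 /= !addr0.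
have -> : lift 0 0 = 1 :> 'I_2 by exact/val_inj.
rewrite !rmorphD !rmorphM /= !mulrDl !mulrDr !mulrA.
by congr (_, _); exact: addrACA.
Qed.

Lemma torus_actM (R : realType) (S T : 'M[int]_2) (xi : torus R) :
  torus_act (S *m T) xi = torus_act S (torus_act T xi).
Proof. by rewrite [torus_act T xi]/torus_act torus_act_pi -plane_actM. Qed.

Definition jointly_mixing_seq (R : realType) (k : nat)
    (T : 'I_k -> nat -> 'M[int]_2) : Prop :=
  forall f : 'I_k.+1 -> torus R -> R,
    (forall i, f i \in Lfun (@haar_torus R) +oo%E) ->
    \int[@haar_torus R]_xi
        ((\prod_(i < k) f (widen_ord (leqnSn k) i) (torus_act (T i n) xi))
         * f ord_max xi)
      @[n --> \oo]
    --> \prod_(i < k.+1) \int[@haar_torus R]_xi f i xi.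

Definition jointly_mixing (R : realType) (k : nat)
    (T : 'I_k -> 'M[int]_2) : Prop :=
  jointly_mixing_seq R (fun i n => T i ^+ n).

Definition complex_eigenvalue (R : realType) (T : 'M[int]_2)
    (lambda : R[i]) : bool :=
  eigenvalue (map_mx intr T : 'M[R[i]]_2) lambda.

Definition hyperbolic (R : realType) (T : 'M[int]_2) : Prop :=
  forall lambda : R[i], complex_eigenvalue T lambda -> `|lambda| != 1.

Definition has_eigenvalue_of_modulus (R : realType) (rho : R)
    (T : 'M[int]_2) : Prop :=
  exists2 lambda : R[i], complex_eigenvalue T lambda & `|lambda| = rho%:C%C.

(* Main.v *)
Require Import Defs.
From HB Require Import structures.
From mathcomp Require Import all_boot all_order all_algebra.
From mathcomp Require Import complex.
From mathcomp Require Import all_classical all_reals all_analysis.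
From mathcomp Require Import measurable_realfun ess_sup_inf ring lra zify.
Import Order.TTheory GRing.Theory Num.Theory.
Import numFieldNormedType.Exports.

(** Joint mixing is decided on characters.  For an integer row vector m, the
    real character [wave m th] sends xi to cos (2 pi m.xi + th), and composing
    it with T changes the frequency m into [m *m T].  By the identity
    cos a cos b = (cos (a + b) + cos (a - b)) / 2, a product of characters
    evaluated at the points T_i^n xi is an average of characters whose
    frequencies are the signed sums of the vectors m_i T_i^n, and a character
    has integral zero unless its frequency vanishes.  So the sequences mix
    jointly exactly when no nontrivial family of integer vectors satisfies

      m_1 T_1^n + ... + m_k T_k^n + m_(k+1) = 0

    for arbitrarily large n ([jointly_mixing_seqP]).  For the passage from
    characters to bounded functions the functions are replaced one at a time:
    when the others are fixed, those for which the convergence holds form a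
    vector space closed under bounded pointwise limits, and a space of this
    kind that contains the characters contains every bounded measurable
    function ([trig_monotone_class]).  The same theorem shows that the
    automorphisms preserve the measure, because they permute the characters of
    nonzero frequency.

    What remains is arithmetic.  Suppose the three conditions hold and consider
    a relation as above.  Let lam be the eigenvalue of T of modulus greater
    than 1; then m T^n = lam^n u + o(1), and u is nonzero when m is, since an
    integer vector cannot be contracted to zero ([expanding_component]).  Let
    rho be the largest modulus of the lam_i with m_i nonzero.  After division by
    rho^n only the matrices with |lam_i| = rho contribute, and there are at most
    two of them.  A cancellation between two would give them a common
    eigenvector u, so that T_1 - T_0 or T_1 + T_0 annihilates u; if that integer
    matrix is nonzero, u is proportional to an integer vector, and an integer
    vector is never an eigenvector of a hyperbolic matrix.  Hence
    T_1 = T_0 or T_1 = - T_0, which is excluded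
    ([asymptotically_independent_powers]).

    Conversely each violated condition produces a persistent relation
    ([conditions_of_independent]).  If T is not hyperbolic, |tr T| <= 2 and T^12
    fixes a nonzero integer vector.  If T_i = T_j or T_i = - T_j, the even
    powers coincide.  If three matrices share rho, their squares have the same
    characteristic polynomial X^2 - tau X + 1, so T_i^(2n) = a_n T_i^2 + b_n
    with the same integers a_n and b_n; a relation that holds for n = 0 and
    n = 1, four linear equations in six integer unknowns, then holds for
    every n. *)

Set Implicit Arguments.
Unset Strict Implicit.
Unset Printing Implicit Defensive.

(** * Two by two matrices of determinant one *)

Section two_by_two.
Local Open Scope ring_scope.

Lemma ord2_cases (P : 'I_2 -> Prop) : P 0 -> P 1 -> forall i, P i.
Proof.
move=> P0 P1 [[|[|//]] i2].
- by rewrite (_ : Ordinal _ = 0)//; exact: val_inj.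
- by rewrite (_ : Ordinal _ = 1)//; exact: val_inj.
Qed.

Lemma sum_ord2 (V : nmodType) (F : 'I_2 -> V) : \sum_(i < 2) F i = F 0 + F 1.
Proof.
by rewrite !big_ord_recl big_ord0 addr0; congr (_ + F _); exact: val_inj.
Qed.

Lemma det_mx22 (A : comNzRingType) (M : 'M[A]_2) :
  \det M = M 0 0 * M 1 1 - M 0 1 * M 1 0.
Proof.
rewrite (expand_det_row _ 0) sum_ord2 /cofactor !det_mx11 !mxE /= expr0 expr1.
have -> : lift 0 0 = 1 :> 'I_2 by exact: val_inj.
have -> : lift 1 0 = 0 :> 'I_2 by exact: val_inj.
by rewrite mul1r mulN1r mulrN.
Qed.

Lemma mxtrace22 (A : comNzRingType) (M : 'M[A]_2) : \tr M = M 0 0 + M 1 1.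
Proof. by rewrite /mxtrace sum_ord2. Qed.

Lemma mulmx_det1 (A : comNzRingType) (M : 'M[A]_2) :
  \det M = 1 -> M *m M = \tr M *: M - 1%:M.
Proof.
rewrite det_mx22 => M1; apply/matrixP; elim/ord2_cases; elim/ord2_cases;
  rewrite !mxE sum_ord2 /= mxtrace22 -?M1 ?subr0; ring.
Qed.

Lemma detX (A : comNzRingType) (M : 'M[A]_2) n : \det (M ^+ n) = \det M ^+ n.
Proof.
elim: n => [|n IH]; first by rewrite !expr0 det1.
by rewrite !exprS det_mulmx IH.
Qed.

(** By Cayley-Hamilton the trace of a power of M is a polynomial in tr M, a
    rescaled Chebyshev polynomial; the degrees 2 and 3 compose to give M^12. *)
Lemma mxtrace_sqr (A : comNzRingType) (M : 'M[A]_2) :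
  \det M = 1 -> \tr (M ^+ 2) = \tr M ^+ 2 - 2.
Proof.
move=> M1; rewrite expr2 -mulmxE mulmx_det1// raddfB /= mxtraceZ mxtrace1.
by rewrite expr2.
Qed.

Lemma mxtrace_cube (A : comNzRingType) (M : 'M[A]_2) :
  \det M = 1 -> \tr (M ^+ 3) = \tr M ^+ 3 - 3 * \tr M.
Proof.
move=> M1; have M2 := mulmx_det1 M1.
have -> : M ^+ 3 = (\tr M ^+ 2 - 1) *: M - \tr M *: 1%:M.
  rewrite exprS expr2 -!mulmxE M2 mulmxBr -scalemxAr M2 mulmx1 scalerBr scalerA.
  by rewrite scalerBl scale1r expr2 addrAC.
rewrite raddfB /= !mxtraceZ mxtrace1; ring.
Qed.

Lemma det_sub1 (A : comNzRingType) (M : 'M[A]_2) :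
  \det M = 1 -> \det (M - 1%:M) = 2 - \tr M.
Proof.
move=> M1; rewrite -[2]/(1 + 1) -[in X in _ = X + _ - _]M1 !det_mx22 mxtrace22 !mxE /=.
rewrite mulr1n mulr0n; ring.
Qed.

(** The characteristic polynomial of M is X^2 - tr M X + 1. *)
Lemma eigenvalue_mx22 (F : fieldType) (M : 'M[F]_2) (a : F) : \det M = 1 ->
  eigenvalue M a = (a ^+ 2 - \tr M * a + 1 == 0).
Proof.
move=> M1; rewrite /eigenvalue /eigenspace kermx_eq0 row_free_unit unitmxE unitfE negbK.
congr (_ == 0); rewrite -M1 !det_mx22 mxtrace22 !mxE /= mulr1n mulr0n; ring.
Qed.

Lemma map_mx_det1 (A : comNzRingType) (T : 'M[int]_2) :
  \det T = 1 -> \det (map_mx intr T : 'M[A]_2) = 1.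
Proof. by move=> T1; rewrite det_map_mx T1. Qed.

Lemma map_mx_trace (A : comNzRingType) (T : 'M[int]_2) :
  \tr (map_mx intr T : 'M[A]_2) = (\tr T)%:~R.
Proof. by rewrite !mxtrace22 !mxE rmorphD. Qed.

(** The adjugate of T is its inverse. *)
Lemma mulmx_det1_eq0 (T : 'M[int]_2) (m : 'rV[int]_2) :
  \det T = 1 -> (m *m T == 0) = (m == 0).
Proof.
move=> T1; apply/eqP/eqP => [mT|->]; last by rewrite mul0mx.
by rewrite -[m]mulmx1 -[1%:M]/((1 : int)%:M) -T1 -mul_mx_adj mulmxA mT mul0mx.
Qed.

End two_by_two.

(** * Real characters of the torus *)

Section waves.
Local Open Scope classical_set_scope.
Local Open Scope quotient_scope.
Local Open Scope ring_scope.
Variable R : realType.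

Definition phase (m : 'rV[int]_2) (v : R * R) : R :=
  (m 0 0)%:~R * v.1 + (m 0 1)%:~R * v.2.

(** The phase depends on the representative only up to an integer, which the
    cosine does not see. *)
Definition wave (m : 'rV[int]_2) (th : R) (xi : torus R) : R :=
  cos (pi *+ 2 * phase m (repr xi) + th).

Lemma cosD2pi_int (x : R) (n : int) : cos (x + pi *+ 2 * n%:~R) = cos x.
Proof.
have cosDn k y : cos (y + pi *+ 2 * k%:R) = cos y :> R.
  by rewrite mulr_natr (periodicn (@cosD2pi R)).
case: n => n; first exact: cosDn.
by rewrite NegzE -(cosDn n.+1) mulrNz mulrN subrK.
Qed.

Lemma phase_int (m : 'rV[int]_2) (v : R * R) :
  v \in @int_lattice R -> phase m v \is a Num.int.
Proof. by move=> /andP[v1 v2]; rewrite rpredD// rpredM// intr_int. Qed.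

Lemma phaseB m v w : phase m (v - w) = phase m v - phase m w.
Proof. by rewrite /phase /=; ring. Qed.

Lemma phaseDl m n v : phase (m + n) v = phase m v + phase n v.
Proof. by rewrite /phase !mxE !rmorphD /=; ring. Qed.

Lemma phaseBl m n v : phase (m - n) v = phase m v - phase n v.
Proof. by rewrite /phase !mxE !rmorphB /=; ring. Qed.

Lemma wave_pi m th v : wave m th (\pi_(torus R) v) = cos (pi *+ 2 * phase m v + th).
Proof.
have /eqP : repr (\pi_(torus R) v) = v %[mod torus R] by rewrite reprK.
rewrite -Quotient.idealrBE => /(phase_int m).
rewrite phaseB /wave; set w := repr _ => /intrP[z /eqP].
rewrite subr_eq => /eqP ->.
by rewrite -[RHS](cosD2pi_int _ z); congr cos; ring.
Qed.

Lemma phase_act m (T : 'M[int]_2) v : phase m (plane_act T v) = phase (m *m T) v.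
Proof.
rewrite /phase /plane_act !mxE !big_ord_recl !big_ord0 /= !addr0.
have -> : lift 0 0 = 1 :> 'I_2 by exact/val_inj.
by rewrite !rmorphD !rmorphM /=; ring.
Qed.

Lemma wave_act m th (T : 'M[int]_2) xi : wave m th (torus_act T xi) = wave (m *m T) th xi.
Proof. by rewrite /torus_act wave_pi phase_act. Qed.

Lemma wave0 th xi : wave 0 th xi = cos th.
Proof. by rewrite /wave /phase !mxE !mul0r addr0 mulr0 add0r. Qed.

(** The product of two characters is an average of two characters, so the
    combinations of characters form an algebra without complex numbers. *)
Lemma waveM m n th ph xi :
  wave m th xi * wave n ph xi =
  2^-1 * wave (m + n) (th + ph) xi + 2^-1 * wave (m - n) (th - ph) xi.
Proof.
rewrite /wave phaseDl phaseBl.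
set x := phase _ _; set y := phase _ _.
have -> : pi *+ 2 * (x + y) + (th + ph) = (pi *+ 2 * x + th) + (pi *+ 2 * y + ph).
  by ring.
have -> : pi *+ 2 * (x - y) + (th - ph) = (pi *+ 2 * x + th) - (pi *+ 2 * y + ph).
  by ring.
by move: (_ + th) (_ + ph) => a b; rewrite cosD cosB; field.
Qed.

Lemma le_norm_wave m th xi : `|wave m th xi| <= 1.
Proof. exact: cos_max. Qed.

(** The sigma-algebra of the torus is the largest one making the projection
    measurable, so measurability can be tested in the plane. *)
Lemma measurable_torusP d (U : measurableType d) (f : torus R -> U) :
  measurable_fun setT (f \o \pi_(torus R)) -> measurable_fun setT f.
Proof.
move=> mf _ A mA; rewrite setTI.
by have := mf measurableT _ mA.
Qed.

Lemma measurable_plane_wave m th :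
  measurable_fun [set: measurableTypeR R * measurableTypeR R]
    (fun v => cos (pi *+ 2 * phase m v + th) : measurableTypeR R).
Proof.
apply: measurableT_comp.
  by apply: continuous_measurable_fun; exact: continuous_cos.
apply: measurable_funD => //; apply: measurable_funM => //.
apply: measurable_funD; apply: measurable_funM => //.
Qed.

Lemma measurable_wave m th : measurable_fun setT (wave m th).
Proof.
apply: measurable_torusP.
rewrite (_ : _ \o _ = fun v => cos (pi *+ 2 * phase m v + th)).
  exact: measurable_plane_wave.
by apply/funext => v; rewrite /= wave_pi.
Qed.

Lemma measurable_torus_act (T : 'M[int]_2) : measurable_fun setT (@torus_act R T).
Proof.
apply: measurable_torusP.
rewrite (_ : _ \o _ = \pi_(torus R) \o plane_act T).
  apply: measurableT_comp; first exact: measurable_pi_torus.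
  apply/measurable_fun_pair => /=.
    by apply: measurable_funD; apply: measurable_funM => //.
  by apply: measurable_funD; apply: measurable_funM => //.
by apply/funext => v; rewrite /= torus_act_pi.
Qed.

End waves.

(** * Integration on the torus *)

Section integration.
Local Open Scope classical_set_scope.
Local Open Scope quotient_scope.
Local Open Scope ring_scope.
Variable R : realType.
Notation mu := (@haar_torus R).
Notation leb := (@lebesgue_measure R).

(** The class of functions on which everything is proved first; an essentially
    bounded function agrees almost everywhere with such a function. *)
Definition bounded_measurable (f : torus R -> R) :=
  measurable_fun setT f /\ exists M, forall xi, `|f xi| <= M.

Lemma bounded_measurable_integrable f :
  bounded_measurable f -> mu.-integrable setT (EFin \o f).
Proof.
move=> [mf [M fM]]; apply: measurable_bounded_integrable => //.
  by rewrite (le_lt_trans (probability_le1 mu measurableT))// ltry.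
exists M; split; first exact: num_real.
by move=> N MN x _; exact: le_trans (fM x) (ltW MN).
Qed.

Lemma bounded_measurable_wave m th : bounded_measurable (@wave R m th).
Proof.
by split; [exact: measurable_wave | exists 1 => xi; exact: le_norm_wave].
Qed.

Lemma bounded_measurable_cst c : bounded_measurable (fun=> c).
Proof. by split=> //; exists `|c|. Qed.

Lemma bounded_measurableD f g : bounded_measurable f -> bounded_measurable g ->
  bounded_measurable (fun xi => f xi + g xi).
Proof.
move=> [mf [M fM]] [mg [N gN]]; split; first exact: measurable_funD.
by exists (M + N) => xi; rewrite (le_trans (ler_normD _ _))// lerD.
Qed.

Lemma bounded_measurableM f g : bounded_measurable f -> bounded_measurable g ->
  bounded_measurable (fun xi => f xi * g xi).
Proof.
move=> [mf [M fM]] [mg [N gN]]; split; first exact: measurable_funM.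
by exists (M * N) => xi; rewrite normrM ler_pM.
Qed.

Lemma bounded_measurableZ c f : bounded_measurable f ->
  bounded_measurable (fun xi => c * f xi).
Proof. exact/bounded_measurableM/bounded_measurable_cst. Qed.

Lemma bounded_measurableB f g : bounded_measurable f -> bounded_measurable g ->
  bounded_measurable (fun xi => f xi - g xi).
Proof.
move=> bf bg; rewrite (_ : (fun _ => _) = fun xi => f xi + -1 * g xi).
  exact/bounded_measurableD/bounded_measurableZ.
by apply/funext => xi; rewrite mulN1r.
Qed.

Lemma bounded_measurable_norm f : bounded_measurable f ->
  bounded_measurable (fun xi => `|f xi|).
Proof.
move=> [mf [M fM]]; split; first exact: measurableT_comp.
by exists M => xi; rewrite normr_id.
Qed.

Lemma bounded_measurable_act T f : bounded_measurable f ->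
  bounded_measurable (fun xi => f (torus_act T xi)).
Proof.
move=> [mf [M fM]]; split; last by exists M.
exact: measurableT_comp mf (@measurable_torus_act R T).
Qed.

Lemma bounded_measurable_prod (I : Type) (r : seq I) (P : pred I)
    (f : I -> torus R -> R) : (forall i, bounded_measurable (f i)) ->
  bounded_measurable (fun xi => \prod_(i <- r | P i) f i xi).
Proof.
move=> bf; elim: r => [|i r IH].
  by under eq_fun do rewrite big_nil; exact: bounded_measurable_cst.
under eq_fun do rewrite big_cons.
by case: (P i) => //; exact: bounded_measurableM.
Qed.

Lemma bounded_measurable_indic (E : set (torus R)) :
  measurable E -> bounded_measurable (\1_E : torus R -> R).
Proof.
move=> mE; split; first exact: measurable_indic.
by exists 1 => xi; rewrite indicE; case: (_ \in _); rewrite ?normr1 ?normr0.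
Qed.

Lemma haarT : mu setT = 1%E.
Proof. exact: (@probability_setT _ _ _ mu). Qed.

Lemma haar_integral_cst c : \int[mu]_xi c = c.
Proof.
rewrite Rintegral_cst// -[RHS]mulr1; congr (_ * _).
exact: (congr1 fine haarT).
Qed.

Lemma haar_integralD f g : bounded_measurable f -> bounded_measurable g ->
  \int[mu]_xi (f xi + g xi) = \int[mu]_xi f xi + \int[mu]_xi g xi.
Proof. by move=> bf bg; apply: RintegralD => //; exact: bounded_measurable_integrable. Qed.

Lemma haar_integralZ c f : bounded_measurable f ->
  \int[mu]_xi (c * f xi) = c * \int[mu]_xi f xi.
Proof. by move=> bf; apply: RintegralZl => //; exact: bounded_measurable_integrable. Qed.

Lemma haar_integralB f g : bounded_measurable f -> bounded_measurable g ->
  \int[mu]_xi (f xi - g xi) = \int[mu]_xi f xi - \int[mu]_xi g xi.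
Proof. by move=> bf bg; apply: RintegralB => //; exact: bounded_measurable_integrable. Qed.

Lemma haar_integral_le f g : bounded_measurable f -> bounded_measurable g ->
  (forall xi, f xi <= g xi) -> \int[mu]_xi f xi <= \int[mu]_xi g xi.
Proof. by move=> bf bg fg; apply: le_Rintegral => //; exact: bounded_measurable_integrable. Qed.

Lemma haar_le_norm_integral f : bounded_measurable f ->
  `|\int[mu]_xi f xi| <= \int[mu]_xi `|f xi|.
Proof. by move=> bf; apply: le_normr_Rintegral => //; exact: bounded_measurable_integrable. Qed.

(** Dominated convergence with a constant bound, integrable because the total
    mass is one. *)
Lemma haar_bounded_convergence (F : nat -> torus R -> R) (f : torus R -> R) (M : R) :
  (forall n, measurable_fun setT (F n)) -> measurable_fun setT f ->
  (forall n xi, `|F n xi| <= M) -> (forall xi, F n xi @[n --> \oo] --> f xi) ->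
  (\int[mu]_xi `|F n xi - f xi| @[n --> \oo] --> 0) /\
  (\int[mu]_xi F n xi @[n --> \oo] --> \int[mu]_xi f xi).
Proof.
move=> mF mf FM Ff.
have [|||||intf h1 h2] := @dominated_convergence _ _ _ mu setT measurableT
  (fun n => EFin \o F n) (EFin \o f) (EFin \o cst M).
- by move=> n; exact/measurable_EFinP.
- exact/measurable_EFinP.
- by apply: aeW => xi _; apply/fine_cvgP; split; [exact: nearW | exact: Ff].
- exact/bounded_measurable_integrable/bounded_measurable_cst.
- by apply: aeW => xi n _; rewrite lee_fin.
split; first exact: (fine_cvg h1).
apply: fine_cvg.
by rewrite /Rintegral fineK; [exact: h2 | exact: integrable_fin_num].
Qed.

Lemma integral_mrestr d (T : measurableType d) (m : {measure set T -> \bar R})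
    (D : set T) (mD : measurable D) (f : T -> \bar R) :
  (mrestr m mD).-integrable setT f ->
  (\int[mrestr m mD]_x f x = \int[m]_(x in D) f x)%E.
Proof.
move=> intf.
rewrite (@negligible_integral _ _ _ (mrestr m mD) setT (~` D))//=.
- rewrite setTD setCK; apply: eq_measure_integral => A mA /setIidPl.
  by move=> AD; rewrite -[in RHS]AD.
- exact: measurableC.
- by rewrite [LHS](_ : _ = m (~` D `&` D))// setICl measure0.
Qed.

Notation plane := (measurableTypeR R * measurableTypeR R)%type.

(** The measure of the torus is the image of Lebesgue measure on the unit square. *)
Lemma haar_integralE f : bounded_measurable f ->
  (\int[mu]_xi (f xi)%:E =
   \int[leb \x leb]_(v in @unit_square R) (f (\pi_(torus R) v))%:E)%E.
Proof.
move=> [mf [M fM]].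
have mfpi : measurable_fun [set: plane] (f \o \pi_(torus R)).
  exact: measurableT_comp mf (@measurable_pi_torus R).
pose nu : {measure set plane -> \bar R} :=
  mrestr (leb \x leb)%E (@measurable_unit_square R).
have nuT : (nu setT < +oo)%E.
  by apply: (@eq_ind _ 1%E (fun x => (x < +oo)%E) (ltry _)); exact/esym/haarT.
have intf : nu.-integrable [set: plane] (EFin \o (f \o \pi_(torus R))).
  apply: measurable_bounded_integrable => //.
  exists M; split; first exact: num_real.
  by move=> N MN x _; exact: le_trans (fM _) (ltW MN).
have h1 := @integral_mrestr _ plane (leb \x leb)%E _ (@measurable_unit_square R) _ intf.
have h2 := @integral_pushforward _ _ plane (torus R) R (\pi_(torus R))
  (@measurable_pi_torus R) nu setT (EFin \o f).
have h3 : measurable_fun [set: torus R] (EFin \o f) by exact/measurable_EFinP.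
have {h2}h4 := h2 h3 intf measurableT.
apply: etrans h1.
apply: (etrans h4).
by [].
Qed.
Lemma integral_cos_period (k : int) (c : R) : k != 0 ->
  (\int[leb]_(x in `[0%R, 1%R[%classic) (cos (pi *+ 2 * k%:~R * x + c))%:E = 0)%E.
Proof.
move=> k0.
set a : R := pi *+ 2 * k%:~R.
have a0 : a != 0 by rewrite mulf_neq0// ?intr_eq0// mulrn_eq0/= gt_eqF// pi_gt0.
pose F (x : R) : R := a^-1 * sin (a * x + c).
have dF (x : R) : is_derive x (1 : R) F (cos (a * x + c)).
  rewrite /F; apply: is_derive_eq.
  by rewrite /GRing.scale /= !(addr0, mulr1, mul0r, add0r); field.
have cF : continuous F.
  by move=> x; apply/differentiable_continuous/derivable1_diffP; case: (dF x).
have cc : continuous (fun x : R => cos (a * x + c)).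
  move=> x; apply: continuous_comp; last exact: continuous_cos.
  by apply: cvgD; [apply: cvgM; [exact: cvg_cst|exact: cvg_id]|exact: cvg_cst].
rewrite integral_itv_bndo_bndc; last first.
  by apply/measurable_EFinP/measurable_funTS; exact: continuous_measurable_fun.
rewrite (@continuous_FTC2 _ _ F) ?ltr01//.
- rewrite /F mulr1 mulr0 add0r -EFinB -mulrBr.
  have -> : sin (a + c) = sin c.
    have h n y : sin (y + pi *+ 2 * n%:R) = sin y :> R.
      by rewrite mulr_natr (periodicn (@sinD2pi R)).
    rewrite /a; case: (k) => n; first by rewrite addrC h.
    by rewrite NegzE addrC mulrNz mulrN -[LHS](h n.+1) subrK.
  by rewrite subrr mulr0.
- exact: continuous_subspaceT.
- split; first by move=> x _; case: (dF x).
  + by apply: cvg_at_right_filter; exact: cF.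
  + by apply: cvg_at_left_filter; exact: cF.
- by move=> x _; rewrite derive1E; case: (dF x).
Qed.

(** One coordinate of m is nonzero; by Fubini the integral over that coordinate
    can be taken first, and it runs over whole periods of the cosine. *)
Lemma haar_integral_wave m th : m != 0 -> \int[mu]_xi wave m th xi = 0.
Proof.
move=> m0; rewrite /Rintegral haar_integralE; last exact: bounded_measurable_wave.
under eq_integral do rewrite wave_pi.
rewrite integral_mkcond.
set f := _ \_ _.
pose D := `[0%R, 1%R[%classic : set (measurableTypeR R).
have fE v : f v = (\1_(@unit_square R) v * cos (pi *+ 2 * phase m v + th))%:E.
  rewrite /f /patch indicE; case: (v \in _) => /=; first by rewrite mul1r.
  by rewrite mul0r.
have mf : measurable_fun setT f.
  rewrite (_ : f = fun v => (\1_(@unit_square R) v *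
    cos (pi *+ 2 * phase m v + th))%:E); last exact/funext/fE.
  apply/measurable_EFinP/measurable_funM; last exact: measurable_plane_wave.
  by apply: measurable_indic; exact: measurable_unit_square.
have intf : (leb \x leb)%E.-integrable setT f.
  apply: (integrable_mkcond _ (@measurable_unit_square R)).1.
  apply: measurable_bounded_integrable; first exact: measurable_unit_square.
  - apply: (@eq_ind _ 1%E (fun x => (x < +oo)%E) (ltry _)).
    by rewrite -haarT /haar_torus /pushforward /mrestr preimage_setT setTI.
  - by apply: measurable_funTS; exact: measurable_plane_wave.
  - exists 1; split; first exact: num_real.
    by move=> N MN x _; exact: le_trans (cos_max _) (ltW MN).
have sq x y : (x, y) \in @unit_square R = (x \in D) && (y \in D).
  by rewrite /unit_square in_setX.
have [m1|m1] := eqVneq (m 0 1) 0.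
- have m00 : m 0 0 != 0.
    apply: contra_neq m0 => m00; apply/rowP; elim/(@ord2_cases) => //; by rewrite mxE.
  rewrite -(integral21_prod_meas1 intf) /=.
  rewrite integral0_eq// => y _; rewrite /fubini_G.
  have [yD|yD] := boolP (y \in D); last first.
    by apply: integral0_eq => x _; rewrite fE indicE sq (negbTE yD) andbF mul0r.
  rewrite -[RHS](integral_cos_period (pi *+ 2 * ((m 0 1)%:~R * y) + th) m00).
  rewrite [RHS]integral_mkcond; apply: eq_integral => x _.
  rewrite /f /patch sq yD andbT; case: ifP => // _.
  by congr (cos _)%:E; rewrite /phase /=; ring.
- rewrite -(integral12_prod_meas1 intf) /=.
  rewrite integral0_eq// => x _; rewrite /fubini_F.
  have [xD|xD] := boolP (x \in D); last first.
    by apply: integral0_eq => y _; rewrite fE indicE sq (negbTE xD) mul0r.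
  rewrite -[RHS](integral_cos_period (pi *+ 2 * ((m 0 0)%:~R * x) + th) m1).
  rewrite [RHS]integral_mkcond; apply: eq_integral => y _.
  rewrite /f /patch sq xD /=; case: ifP => // _.
  by congr (cos _)%:E; rewrite /phase /=; ring.
Qed.

End integration.

(** * Polynomial step functions and arcs of the circle *)

Section real_estimates.
Local Open Scope classical_set_scope.
Local Open Scope quotient_scope.
Local Open Scope ring_scope.
Variable R : realType.

Lemma bernoulli_ineq (x : R) n : -1 <= x -> 1 + n%:R * x <= (1 + x) ^+ n.
Proof.
move=> x1; elim: n => [|n IH]; first by rewrite mul0r addr0 expr0.
rewrite exprS -natr1; apply: (@le_trans _ _ ((1 + x) * (1 + n%:R * x))).
  have : 0 <= n%:R * x ^+ 2 by rewrite mulr_ge0 ?sqr_ge0.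
  by rewrite expr2; lra.
by apply: ler_wpM2l => //; lra.
Qed.

Lemma cvg_harmonic_bound (u : nat -> R) (l C : R) :
  (forall n, `|u n - l| * n%:R <= C) -> u n @[n --> \oo] --> l.
Proof.
move=> h; apply/cvgrPdist_le => e e0.
near=> n.
have n0 : 0 < n%:R :> R by rewrite ltr0n; near: n; exact: nbhs_infty_gt.
rewrite distrC -(ler_pM2r n0) (le_trans (h n))// -ler_pdivrMl//.
by near: n; exact: nbhs_infty_ger.
Unshelve. all: by end_near. Qed.

(** Polynomials in y that converge to the indicator of y < 1/2 at every point of
    the unit interval.  With N = n^2 and a = n 2^N, Bernoulli's inequality
    gives 1 - a y^N <= (1 - y^N)^a, where a y^N = n (2y)^N tends to 0 if
    2y < 1, and (1 - y^N)^a <= 1 / (1 + a y^N) <= 1 / (1 + n) if 2y >= 1.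
    The factor n in the exponent takes care of the point y = 1/2, and the square
    in N makes n (2y)^N small by Bernoulli's inequality again. *)
Lemma cvg_step_poly (y : R) : 0 <= y <= 1 ->
  (1 - y ^+ (n ^ 2)) ^+ (n * 2 ^ (n ^ 2)) @[n --> \oo] --> ((y < 2^-1)%R%:R : R).
Proof.
move=> /andP[y0 y1].
have yn n : 0 <= y ^+ n <= 1 by rewrite exprn_ge0// exprn_ile1.
have mulE n : (n * 2 ^ (n ^ 2))%N%:R * y ^+ (n ^ 2) = n%:R * (2 * y) ^+ (n ^ 2).
  by rewrite natrM natrX exprMn mulrA.
have q01 n a : 0 <= (1 - y ^+ n) ^+ a <= 1.
  have /andP[h0 h1] := yn n.
  by rewrite exprn_ge0 ?subr_ge0// exprn_ile1 ?subr_ge0// lerBlDr lerDl.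
case: ltP => hy; last first.
  apply: (@cvg_harmonic_bound _ _ 1) => n; rewrite subr0.
  have /andP[t0 t1] := yn (n ^ 2)%N.
  have /andP[Q0 Q1] := q01 (n ^ 2)%N (n * 2 ^ (n ^ 2))%N.
  rewrite ger0_norm//; set t := y ^+ _ in t0 t1 Q0 Q1 *; set a := (n * _)%N in Q0 Q1 *.
  apply: (@le_trans _ _ ((1 - t) ^+ a * (1 + t) ^+ a)).
    apply: ler_wpM2l => //; apply: le_trans (bernoulli_ineq _ _); last by lra.
    rewrite mulE; apply: (@le_trans _ _ (n%:R * (2 * y) ^+ (n ^ 2))); last by lra.
    by rewrite ler_peMr// exprn_ege1//; lra.
  by rewrite -exprMn exprn_ile1//; nra.
have h0 : 0 < 1 - 2 * y by lra.
apply: (@cvg_harmonic_bound _ _ (1 - 2 * y)^-1) => n.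
have /andP[t0 t1] := yn (n ^ 2)%N.
have /andP[Q0 Q1] := q01 (n ^ 2)%N (n * 2 ^ (n ^ 2))%N.
rewrite distrC ger0_norm ?subr_ge0//.
rewrite -div1r ler_pdivlMr//.
set h := 1 - 2 * y in h0 *.
have B1 : 1 - (1 - y ^+ (n ^ 2)) ^+ (n * 2 ^ (n ^ 2)) <= n%:R * (2 * y) ^+ (n ^ 2).
  rewrite -mulE lerBlDr -lerBlDl.
  have := @bernoulli_ineq (- y ^+ (n ^ 2)) (n * 2 ^ (n ^ 2)).
  by rewrite mulrN; apply; lra.
have B2 : (2 * y) ^+ (n ^ 2) * (1 + (n ^ 2)%N%:R * h) <= 1.
  apply: (@le_trans _ _ ((2 * y) ^+ (n ^ 2) * (1 + h) ^+ (n ^ 2))).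
    by apply: ler_wpM2l; [rewrite exprn_ge0//; lra | apply: bernoulli_ineq; lra].
  rewrite -exprMn exprn_ile1//; first by rewrite mulr_ge0; lra.
  by rewrite /h; have := sqr_ge0 (1 - 2 * y); rewrite expr2; nra.
apply: (@le_trans _ _ (n%:R * (2 * y) ^+ (n ^ 2) * n%:R * h)).
  by apply: ler_wpM2r; [exact: ltW | apply: ler_wpM2r].
apply: le_trans B2; rewrite natrX expr2.
set w := (2 * y) ^+ _.
have w0 : 0 <= w by rewrite exprn_ge0//; lra.
have -> : n%:R * w * n%:R * h = w * (n%:R * n%:R * h) by ring.
by apply: ler_wpM2l => //; lra.
Qed.

Lemma cos_lt_cos (b y : R) : 0 <= b -> b < y -> y < pi *+ 2 - b -> cos y < cos b.
Proof.
move=> b0 b_y yb.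
have [ypi|piy] := leP y pi.
  by rewrite ltr_cos// in_itv/= ?b0 ?(le_trans b0 (ltW b_y)) ?ypi// (le_trans (ltW b_y)).
rewrite -(cosN y) -(cosD2pi (- y)) ltr_cos ?in_itv/=.
- by move: b_y yb piy; rewrite mulr2n; lra.
- by apply/andP; split; move: b_y yb piy; rewrite mulr2n; lra.
- by apply/andP; split; move: b_y yb piy; rewrite mulr2n; lra.
Qed.

(** The interval [0, a) of the circle is the open arc centred at a / 2, which is
    described by a cosine inequality, together with the point 0. *)
Lemma lt_arc (x a : R) : 0 <= x < 1 -> 0 < a < 1 ->
  x < a <-> cos (pi * a) < cos (pi *+ 2 * x - pi * a) \/ 1 <= cos (pi *+ 2 * x).
Proof.
move=> /andP[x0 x1] /andP[a0 a1]; have p0 := pi_gt0 R.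
have [xa|ax] := ltP x a; split=> //.
- move=> _; have [->|xneq0] := eqVneq x 0; first by right; rewrite mulr0 cos0.
  have {}x0 : 0 < x by rewrite lt_neqAle eq_sym xneq0.
  left; set z := _ - _; rewrite -(cos_norm z).
  have zlt : `|z| < pi * a by rewrite ltr_norml /z mulr2n; nra.
  by rewrite ltr_cos ?in_itv/= ?normr_ge0//=; nra.
- case=> [h|h].
  + suff : cos (pi *+ 2 * x - pi * a) <= cos (pi * a) by rewrite leNgt h.
    have [<-|ax'] := eqVneq a x; first by rewrite (_ : _ - _ = pi * a) ?lexx// mulr2n; ring.
    apply/ltW/cos_lt_cos; first by nra.
    * have : a < x by rewrite lt_neqAle ax'.
      by rewrite mulr2n; nra.
    * by rewrite mulr2n; nra.
  + suff : cos (pi *+ 2 * x) < 1 by rewrite ltNge h.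
    by rewrite -cos0; apply: cos_lt_cos => //; rewrite ?subr0 mulr2n; nra.
Qed.

End real_estimates.

(** * Trigonometric polynomials generate the Borel sets *)

Section trig.
Local Open Scope classical_set_scope.
Local Open Scope quotient_scope.
Local Open Scope ring_scope.
Variable R : realType.

(** The span of the characters, in inductive form so that closure of a class
    under linear combinations is an induction. *)
Inductive trig_poly : (torus R -> R) -> Prop :=
| trig_wave m th : trig_poly (wave m th)
| trigD f g : trig_poly f -> trig_poly g -> trig_poly (fun xi => f xi + g xi)
| trigZ c f : trig_poly f -> trig_poly (fun xi => c * f xi).

(** Bilinearity reduces this to [waveM]. *)
Lemma trigM f g : trig_poly f -> trig_poly g -> trig_poly (fun xi => f xi * g xi).
Proof.
elim=> [m th|f1 f2 _ IH1 _ IH2|c f1 _ IH1] tg.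
- elim: tg => [n ph|g1 g2 _ IH1 _ IH2|c g1 _ IH1].
  + rewrite (_ : (fun _ => _) = fun xi => 2^-1 * wave (m + n) (th + ph) xi +
      2^-1 * wave (m - n) (th - ph) xi); last by apply/funext => xi; exact: waveM.
    by apply: trigD; apply: trigZ; exact: trig_wave.
  + under eq_fun do rewrite mulrDr; exact: trigD.
  + under eq_fun do rewrite mulrCA; exact: trigZ.
- under eq_fun do rewrite mulrDl; exact: trigD (IH1 tg) (IH2 tg).
- under eq_fun do rewrite -mulrA; exact: trigZ (IH1 tg).
Qed.

Lemma trig_cst c : trig_poly (fun=> c).
Proof.
rewrite (_ : (fun=> c) = fun xi => c * wave 0 0 xi); first exact/trigZ/trig_wave.
by apply/funext => xi; rewrite wave0 cos0 mulr1.
Qed.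

Lemma trigX f n : trig_poly f -> trig_poly (fun xi => f xi ^+ n).
Proof.
move=> tf; elim: n => [|n IH]; first by under eq_fun do rewrite expr0; exact: trig_cst.
under eq_fun do rewrite exprS; exact: trigM.
Qed.

Lemma trig_bounded_measurable f : trig_poly f -> bounded_measurable f.
Proof.
elim=> [m th|f1 f2 _ ? _ ?|c f1 _ ?].
- exact: bounded_measurable_wave.
- exact: bounded_measurableD.
- exact: bounded_measurableZ.
Qed.

(** Sets whose indicator is an everywhere pointwise limit of trigonometric
    polynomials with values in the unit interval.  The bounds on the values make
    this class stable under intersection: multiply the approximations. *)
Definition trig_limit_set : set (set (torus R)) := [set E |
  exists F : nat -> torus R -> R, [/\ forall n, trig_poly (F n),
    forall n xi, 0 <= F n xi <= 1 &
    forall xi, F n xi @[n --> \oo] --> (\1_E xi : R)]].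

Lemma trig_limit_setI : setI_closed trig_limit_set.
Proof.
move=> A B [F [tF F01 FA]] [G [tG G01 GB]].
exists (fun n xi => F n xi * G n xi); split.
- by move=> n; exact: trigM.
- by move=> n xi; case/andP: (F01 n xi) => ? ?; case/andP: (G01 n xi) => ? ?;
    rewrite mulr_ge0 ?mulr_ile1.
- by move=> xi; rewrite indicI; exact: cvgM.
Qed.

(** Rescale g to take values in the unit interval with threshold 1/2 and apply
    [cvg_step_poly]; a polynomial in g is again a trigonometric polynomial. *)
Lemma trig_limit_set_lt0 g : trig_poly g -> trig_limit_set [set xi | g xi < 0].
Proof.
move=> tg; have [_ [M gM]] := trig_bounded_measurable tg.
pose N := `|M| + 1.
have N0 : 0 < N by rewrite ltr_wpDl.
have gN xi : `|g xi| <= N by rewrite (le_trans (gM xi))// (le_trans (ler_norm M))// lerDl.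
pose y xi := 2^-1 + (2 * N)^-1 * g xi.
have ty : trig_poly y by apply: trigD; [exact: trig_cst | exact: trigZ].
have y01 xi : 0 <= y xi <= 1.
  have := gN xi; rewrite ler_norml => /andP[h1 h2].
  have e : N * (2 * N)^-1 = 2^-1 by rewrite invfM mulrCA divff ?mulr1// gt_eqF.
  have p : 0 < (2 * N)^-1 by rewrite invr_gt0 mulr_gt0.
  by rewrite /y; apply/andP; split; nra.
exists (fun n xi => (1 + -1 * y xi ^+ (n ^ 2)) ^+ (n * 2 ^ (n ^ 2))); split.
- move=> n; apply: trigX; apply: trigD; first exact: trig_cst.
  exact/trigZ/trigX.
- move=> n xi; case/andP: (y01 xi) => y0 y1; rewrite mulN1r.
  have h0 : 0 <= y xi ^+ (n ^ 2) by rewrite exprn_ge0.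
  have h1 : y xi ^+ (n ^ 2) <= 1 by rewrite exprn_ile1.
  by rewrite exprn_ge0 ?subr_ge0// exprn_ile1 ?subr_ge0// lerBlDr lerDl.
- move=> xi; under eq_fun do rewrite mulN1r.
  rewrite (_ : \1_ _ _ = ((y xi < 2^-1)%R%:R : R)); first exact: cvg_step_poly.
  rewrite indicE; congr (nat_of_bool _)%:R; apply/idP/idP; rewrite inE /y /=.
    by move=> gx; rewrite gtrDl pmulr_rlt0// invr_gt0 mulr_gt0.
  by rewrite gtrDl pmulr_rlt0// invr_gt0 mulr_gt0.
Qed.

Lemma cvg_indic_measurable (E : set (torus R)) (F : nat -> torus R -> R) :
  (forall n, measurable_fun setT (F n)) ->
  (forall xi, F n xi @[n --> \oo] --> (\1_E xi : R)) -> measurable E.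
Proof.
move=> mF FE.
have /(_ measurableT [set 1%:E]) : measurable_fun setT (EFin \o (\1_E : torus R -> R)).
  apply: (emeasurable_fun_cvg (fun n => EFin \o F n)).
    by move=> n; exact/measurable_EFinP.
  by move=> xi _; apply/fine_cvgP; split; [exact: nearW | exact: FE].
rewrite setTI => /(_ (emeasurable_set1 _)).
rewrite (_ : _ @^-1` _ = E)//; apply/seteqP; split => xi /=.
  by rewrite indicE; have [|_ [/eqP]] := boolP (xi \in E); [rewrite inE|rewrite eq_sym oner_eq0].
by move=> Exi; rewrite indicE mem_set.
Qed.

(** Together the two coordinates are a section of the projection, with values
    in the unit square ([torus_coordK]). *)
Definition torus_coord (i : 'I_2) (xi : torus R) : R :=
  let x := phase (delta_mx 0 i) (repr xi) in x - (Num.floor x)%:~R.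

Lemma torus_coord_itv i xi : 0 <= torus_coord i xi < 1.
Proof.
rewrite /torus_coord subr_ge0 ltrBlDr floor_le /=.
by have := floorD1_gt (phase (delta_mx 0 i) (repr xi)); rewrite rmorphD/= addrC.
Qed.

Lemma wave_coord i th xi :
  wave (delta_mx 0 i) th xi = cos (pi *+ 2 * torus_coord i xi + th).
Proof.
rewrite /wave /torus_coord; set x := phase _ _.
by rewrite -[RHS](cosD2pi_int _ (Num.floor x)); congr cos; ring.
Qed.

Lemma torus_coordK xi : \pi_(torus R) (torus_coord 0 xi, torus_coord 1 xi) = xi.
Proof.
rewrite -[RHS]reprK; apply/eqP; rewrite -Quotient.idealrBE /torus_coord /phase !mxE /=.
rewrite !(mul1r, mul0r, addr0, add0r); apply/andP => /=.
by split; rewrite addrAC subrr add0r rpredN intr_int.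
Qed.

(** A Borel set of the torus is the inverse image, under the section given by
    the two coordinates, of a Borel set of the plane; each coordinate is
    measurable for the generated sigma-algebra because of [lt_arc] and
    [trig_limit_set_lt0]. *)
Lemma torus_measurable_sub_sigma (A : set (torus R)) :
  measurable A -> <<s trig_limit_set >> A.
Proof.
pose gT := g_sigma_algebraType trig_limit_set.
have mlt0 g : trig_poly g -> measurable ([set xi | g xi < 0] : set gT).
  move=> tg; apply: sub_sigma_algebra; exact: trig_limit_set_lt0.
have mco i : measurable_fun [set: gT] (torus_coord i : gT -> measurableTypeR R).
  apply: (measurability _ (RGenCInfty.measurableE R)) => _ [_ [a ->] <-].
  rewrite setTI -[X in measurable X]setCK; apply: measurableC.
  rewrite (_ : ~` _ = [set xi | torus_coord i xi < a]); last first.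
    by apply/seteqP; split => xi /=; rewrite in_itv/= andbT ltNge; move/negP.
  have [a0|a0] := leP a 0.
    rewrite (_ : [set _ | _] = set0); first exact: measurable0.
    apply/seteqP; split => // xi /=; have /andP[+ _] := torus_coord_itv i xi.
    by move=> h1 h2; have := le_lt_trans h1 h2; rewrite ltNge a0.
  have [a1|a1] := leP 1 a.
    rewrite (_ : [set _ | _] = setT); first exact: measurableT.
    apply/seteqP; split => // xi /= _; have /andP[_ +] := torus_coord_itv i xi.
    by move=> /lt_le_trans; apply.
  rewrite (_ : [set _ | _] =
    [set xi | cos (pi * a) + -1 * wave (delta_mx 0 i) (- (pi * a)) xi < 0] `|`
    ~` [set xi | wave (delta_mx 0 i) 0 xi + -1 < 0]).
    apply: measurableU.
      exact: mlt0 (trigD (trig_cst _) (trigZ _ (trig_wave _ _))).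
    by apply: measurableC; exact: mlt0 (trigD (trig_wave _ _) (trig_cst _)).
  have a01 : 0 < a < 1 by rewrite a0.
  apply/seteqP; split => xi /=.
  - move/(lt_arc (torus_coord_itv i xi) a01) => [h|h]; [left|right].
      by rewrite mulN1r subr_lt0 wave_coord.
    by apply/negP; rewrite -leNgt subr_ge0 wave_coord addr0.
  - move=> h; apply/(lt_arc (torus_coord_itv i xi) a01); case: h => h; [left|right].
      by move: h; rewrite mulN1r subr_lt0 wave_coord.
    by move: h => /negP; rewrite -leNgt subr_ge0 wave_coord addr0.
move=> mA.
have -> : A = (fun xi : gT => (torus_coord 0 xi, torus_coord 1 xi)) @^-1`
    (\pi_(torus R) @^-1` A).
  by apply/seteqP; split => xi /=; rewrite torus_coordK.
have := measurable_fun_pair (mco 0) (mco 1).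
move=> /(_ measurableT (\pi_(torus R) @^-1` A)); rewrite setTI; apply.
by have := @measurable_pi_torus R measurableT _ mA; rewrite setTI.
Qed.

End trig.

(** * A monotone class theorem for characters *)

Section trig_class.
Import HBNNSimple.
Local Open Scope classical_set_scope.
Local Open Scope quotient_scope.
Local Open Scope ring_scope.
Variable R : realType.
Notation mu := (@haar_torus R).

(** The sets whose indicator lies in V form a lambda-system, which contains the
    pi-system of [trig_limit_set]; by Dynkin's theorem it contains all Borel sets.
    Simple functions follow by linearity and bounded measurable functions by
    increasing approximation. *)
Theorem trig_monotone_class (V : (torus R -> R) -> Prop) :
  (forall m th, V (wave m th)) ->
  (forall f g, bounded_measurable f -> bounded_measurable g ->
     V f -> V g -> V (fun xi => f xi + g xi)) ->
  (forall c f, bounded_measurable f -> V f -> V (fun xi => c * f xi)) ->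
  (forall (F : nat -> torus R -> R) (f : torus R -> R) (M : R),
     (forall n, measurable_fun setT (F n)) -> measurable_fun setT f ->
     (forall n xi, `|F n xi| <= M) -> (forall xi, F n xi @[n --> \oo] --> f xi) ->
     (forall n, V (F n)) -> V f) ->
  forall f, bounded_measurable f -> V f.
Proof.
move=> Vwave VD VZ Vlim.
have Vtrig f : trig_poly f -> V f.
  elim=> [//|f1 f2 /trig_bounded_measurable b1 V1 /trig_bounded_measurable b2 V2|].
    exact: VD.
  by move=> c g /trig_bounded_measurable bg Vg; exact: VZ.
have Vcst c : V (fun=> c) by apply: Vtrig; exact: trig_cst.
have Vindic (E : set (torus R)) : measurable E -> V (\1_E).
  move=> mE.
  pose H := [set E : set (torus R) | measurable E /\ V (\1_E)].
  suff : H E by case.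
  apply: (@lambda_system_subset _ (@trig_limit_set R) (@trig_limit_setI R) setT H);
    [| | by [] | exact: torus_measurable_sub_sigma].
  - split => //.
    + split; first exact: measurableT.
      by rewrite indicT; exact: Vcst.
    + move=> A B BA [mA VA] [mB VB]; split; first exact: measurableD.
      rewrite (_ : \1_ _ = fun xi => (\1_A xi : R) + -1 * \1_B xi).
        apply: VD; [exact: bounded_measurable_indic | | exact: VA |].
          exact/bounded_measurableZ/bounded_measurable_indic.
        by apply: VZ => //; exact: bounded_measurable_indic.
      apply/funext => xi; rewrite mulN1r setDE indicI indicC /=.
      have [Bx|Bx] := boolP (xi \in B); last first.
        by rewrite [\1_B xi]indicE (negbTE Bx) !subr0 mulr1.
      by rewrite !indicE Bx (mem_set (BA _ (set_mem Bx))) subrr mulr0.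
    + move=> F ndF HF.
      have mF : measurable (\bigcup_i F i).
        by apply: bigcupT_measurable => n; case: (HF n).
      split => //.
      apply: (Vlim (fun n => \1_(F n)) _ 1).
      * by move=> n; case: (HF n) => /bounded_measurable_indic[].
      * by case: (bounded_measurable_indic mF).
      * by move=> n xi; rewrite indicE; case: (_ \in _); rewrite ?normr1 ?normr0.
      * move=> xi; have [[N _ FN]|nF] := pselect ((\bigcup_i F i) xi).
          apply: cvg_near_cst; exists N => // n /= Nn.
          rewrite !indicE !mem_set//; first by exists N.
          by move/subsetPset : (ndF _ _ Nn); apply.
        apply: cvg_near_cst; apply: nearW => n; rewrite !indicE !memNset//.
        by apply: contra_not nF => Fn; exists n.
      * by move=> n; case: (HF n).
  - move=> A [F [tF F01 FA]].
    have mF n : measurable_fun setT (F n) by case: (trig_bounded_measurable (tF n)).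
    have mA : measurable A by exact: cvg_indic_measurable mF FA.
    split=> //; apply: (Vlim F _ 1) mF _ _ FA _.
    + by case: (bounded_measurable_indic mA).
    + by move=> n xi; case/andP: (F01 n xi) => F0 F1; rewrite ger0_norm.
    + by move=> n; exact: Vtrig.
have Vsum n (s : seq R) (E : nat -> set (torus R)) : (forall i, measurable (E i)) ->
    V (fun xi => \sum_(i < n) (s`_i * \1_(E i) xi)) /\
    bounded_measurable (fun xi => \sum_(i < n) (s`_i * \1_(E i) xi)).
  move=> mE; elim: n => [|n [IH1 IH2]].
    by split; under eq_fun do rewrite big_ord0; [exact: Vcst|exact: bounded_measurable_cst].
  have bn : bounded_measurable (fun xi => s`_n * \1_(E n) xi).
    exact/bounded_measurableZ/bounded_measurable_indic.
  split; under eq_fun do rewrite big_ord_recr.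
    by apply: VD => //; apply: VZ; [exact: bounded_measurable_indic|exact: Vindic].
  exact: bounded_measurableD.
have Vnnsfun (h : {nnsfun torus R >-> R}) : V h.
  have := @fimfunEord _ R h; rewrite /=; set s := finmap.enum_fset _ => hE.
  rewrite (_ : (h : torus R -> R) = fun xi => \sum_(i < size s)
      (s`_i * \1_(h @^-1` [set s`_i]) xi)); last exact/funext/hE.
  have mh i : measurable (h @^-1` [set s`_i]).
    by rewrite -[_ @^-1` _]setTI; exact: (measurable_funPT h).
  by have [Vs _] := Vsum (size s) s _ mh.
move=> f bf; have [mf [M fM]] := bf.
pose g xi := f xi + M.
have bg : bounded_measurable g by exact/bounded_measurableD/bounded_measurable_cst.
have g0 xi : 0 <= g xi by have := fM xi; rewrite ler_norml /g => /andP[]; lra.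
have mg : measurable_fun setT (EFin \o g) by apply/measurable_EFinP; case: bg.
have Vg : V g.
  pose h := nnsfun_approx measurableT mg.
  have hg n xi : h n xi <= g xi.
    by rewrite -lee_fin /h nnsfun_approxE; apply: le_approx => // y _; rewrite lee_fin.
  apply: (Vlim (fun n => h n : torus R -> R) _ (M + M)).
  - by move=> n; exact: measurable_funPT.
  - by case: bg.
  - move=> n xi; rewrite ger0_norm//; apply: le_trans (hg n xi) _.
    by have := fM xi; rewrite ler_norml /g => /andP[]; lra.
  - move=> xi; have hx : EFin \o h^~ xi @ \oo --> (g xi)%:E.
      by apply: (cvg_nnsfun_approx measurableT mg) => // y _; rewrite lee_fin.
    exact: (fine_cvg hx).
  - by move=> n; exact: Vnnsfun.
have -> : f = fun xi => g xi + - M by apply/funext => xi; rewrite /g addrK.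
exact: VD bg (bounded_measurable_cst _) Vg (Vcst _).
Qed.

(** Both sides agree on characters, as T permutes the nonzero frequencies. *)
Lemma haar_integral_act (T : 'M[int]_2) (f : torus R -> R) :
  \det T = 1 -> bounded_measurable f ->
  \int[mu]_xi f (torus_act T xi) = \int[mu]_xi f xi.
Proof.
move=> T1; move: f; apply: trig_monotone_class.
- move=> m th; under eq_Rintegral do rewrite wave_act.
  have [->|m0] := eqVneq m 0; first by rewrite mul0mx.
  by rewrite !haar_integral_wave// mulmx_det1_eq0.
- move=> f g bf bg If Ig.
  rewrite (haar_integralD bf bg) -If -Ig.
  exact: haar_integralD (bounded_measurable_act T bf) (bounded_measurable_act T bg).
- move=> c f bf If.
  by rewrite (haar_integralZ c bf) -If (haar_integralZ c (bounded_measurable_act T bf)).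
- move=> F f M mF mf FM Ff IF.
  have mT := @measurable_torus_act R T.
  have [_ h1] := haar_bounded_convergence mF mf FM Ff.
  have [_ h2] := @haar_bounded_convergence R (fun n xi => F n (torus_act T xi))
    (fun xi => f (torus_act T xi)) M (fun n => measurableT_comp (mF n) mT)
    (measurableT_comp mf mT) (fun n xi => FM n _) (fun xi => Ff _).
  apply: (cvg_unique _ h2) => //.
  by apply: cvg_trans h1; apply: near_eq_cvg; apply: nearW => n; rewrite /= IF.
Qed.

(** A tool for replacing one function at a time.  Closure under limits holds
    because the automorphisms preserve the measure: the error made by replacing g
    by an approximation is at most C times its distance to g in the mean,
    uniformly in n. *)
Lemma mixing_monotone_class (A : nat -> 'M[int]_2) (h : nat -> torus R -> R) (C c : R) :
  (forall n, \det (A n) = 1) ->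
  (forall n, measurable_fun setT (h n)) -> (forall n xi, `|h n xi| <= C) ->
  (forall m th, \int[mu]_xi (wave m th (torus_act (A n) xi) * h n xi) @[n --> \oo]
     --> \int[mu]_xi wave m th xi * c) ->
  forall g, bounded_measurable g ->
  \int[mu]_xi (g (torus_act (A n) xi) * h n xi) @[n --> \oo] --> \int[mu]_xi g xi * c.
Proof.
move=> A1 mh hC hwave.
have bh n : bounded_measurable (h n) by split; [exact: mh|exists C].
have bA n (g : torus R -> R) : bounded_measurable g ->
    bounded_measurable (fun xi => g (torus_act (A n) xi)).
  exact: bounded_measurable_act.
have bAh n g : bounded_measurable g ->
    bounded_measurable (fun xi => g (torus_act (A n) xi) * h n xi).
  by move=> bg; apply: bounded_measurableM (bh n); exact: bA.
apply: trig_monotone_class => //.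
- move=> f g bf bg If Ig; rewrite (haar_integralD bf bg) mulrDl.
  under eq_fun do (under eq_Rintegral do rewrite mulrDl; rewrite haar_integralD ; [|exact: bAh..]).
  exact: cvgD.
- move=> a f bf If; rewrite (haar_integralZ a bf) -mulrA.
  under eq_fun do (under eq_Rintegral do rewrite -mulrA; rewrite haar_integralZ ; [|exact: bAh..]).
  by apply: cvgM => //; exact: cvg_cst.
- move=> F f M mF mf FM Ff IF.
  have bF p : bounded_measurable (F p) by split; [|exists M].
  have bf : bounded_measurable f.
    split => //; exists M => xi.
    have nF : `|F n xi| @[n --> \oo] --> `|f xi| by exact: cvg_norm (Ff xi).
    rewrite -(cvg_lim _ nF)//; apply: limr_le; first exact: cvgP nF.
    by apply: nearW => n; exact: FM.
  have [d1 d2] := haar_bounded_convergence mF mf FM Ff.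
  have C0 : 0 <= C by apply: le_trans (hC 0%N (0 : torus R)); exact: normr_ge0.
  apply/cvgrPdist_le => e e0.
  (* A third of e for each of the three differences; the summands 1 keep the
     denominators positive when C or c vanishes. *)
  have e3 : 0 < e / (3 * (1 + C)) by rewrite divr_gt0// mulr_gt0//; lra.
  have e4 : 0 < e / (3 * (1 + `|c|)) by rewrite divr_gt0// mulr_gt0// ltr_pwDl.
  have [p [P1 P2]] : exists p, \int[mu]_xi `|F p xi - f xi| <= e / (3 * (1 + C)) /\
      `|\int[mu]_xi f xi - \int[mu]_xi F p xi| <= e / (3 * (1 + `|c|)).
    move/cvgrPdist_le : d1 => /(_ _ e3) d1; move/cvgrPdist_le : d2 => /(_ _ e4) d2.
    have [p [p1 p2]] := filter_ex (filterI d1 d2).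
    exists p; split => //; move: p1; rewrite sub0r normrN; apply: le_trans.
    exact: ler_norm.
  have e5 : 0 < e / 3 by rewrite divr_gt0.
  move/cvgrPdist_le : (IF p) => /(_ _ e5); apply: filterS => n hn.
  have K1 : `|\int[mu]_xi (F p (torus_act (A n) xi) * h n xi) -
      \int[mu]_xi (f (torus_act (A n) xi) * h n xi)| <= e / 3.
    rewrite -haar_integralB; [|exact: bAh..].
    have bB : bounded_measurable (fun xi => F p xi - f xi) by exact: bounded_measurableB.
    have nB := bounded_measurable_norm (bA n _ bB).
    apply: (@le_trans _ _ (\int[mu]_xi (C * `|F p (torus_act (A n) xi) - f (torus_act (A n) xi)|))).
      apply: le_trans (haar_le_norm_integral _) _.
        by apply: bounded_measurableB; exact: bAh.
      apply: haar_integral_le.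
      - by apply/bounded_measurable_norm/bounded_measurableB; exact: bAh.
      - exact: (bounded_measurableZ C nB).
      - by move=> xi; rewrite -mulrBl normrM mulrC ler_wpM2r.
    rewrite (haar_integralZ C nB).
    rewrite (haar_integral_act (A1 n) (bounded_measurable_norm bB)).
    apply: (@le_trans _ _ (C * (e / (3 * (1 + C))))); first exact: ler_wpM2l.
    have -> : C * (e / (3 * (1 + C))) = (e / 3) * (C / (1 + C)) by field; lra.
    by rewrite ler_piMr ?(ltW e5)// ler_pdivrMr; lra.
  have K2 : `|\int[mu]_xi f xi * c - \int[mu]_xi F p xi * c| <= e / 3.
    rewrite -mulrBl normrM.
    apply: (@le_trans _ _ (e / (3 * (1 + `|c|)) * `|c|)); first exact: ler_wpM2r.
    have c0 := normr_ge0 c.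
    have -> : e / (3 * (1 + `|c|)) * `|c| = (e / 3) * (`|c| / (1 + `|c|)) by field; lra.
    by rewrite ler_piMr ?(ltW e5)// ler_pdivrMr; lra.
  have := ler_distD (\int[mu]_xi F p xi * c) (\int[mu]_xi f xi * c)
    (\int[mu]_xi (f (torus_act (A n) xi) * h n xi)).
  have := ler_distD (\int[mu]_xi (F p (torus_act (A n) xi) * h n xi)) (\int[mu]_xi F p xi * c)
    (\int[mu]_xi (f (torus_act (A n) xi) * h n xi)).
  by move: K1 K2 hn; lra.
Qed.

End trig_class.

(** * Joint mixing as independence of frequencies *)

Section criterion.
Local Open Scope classical_set_scope.
Local Open Scope quotient_scope.
Local Open Scope ring_scope.
Variable R : realType.
Notation mu := (@haar_torus R).

Lemma bounded_measurable_wave_prod (I : Type) (r : seq I) (v : I -> 'rV[int]_2)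
    (th : I -> R) w ph :
  bounded_measurable (fun xi => wave w ph xi * \prod_(i <- r) wave (v i) (th i) xi).
Proof.
apply: bounded_measurableM; first exact: bounded_measurable_wave.
by apply: bounded_measurable_prod => i; exact: bounded_measurable_wave.
Qed.

Lemma integral_wave_prod_cons (I : Type) (i : I) (r : seq I) (v : I -> 'rV[int]_2)
    (th : I -> R) w ph :
  \int[mu]_xi (wave w ph xi * \prod_(j <- i :: r) wave (v j) (th j) xi) =
  2^-1 * \int[mu]_xi (wave (w + v i) (ph + th i) xi * \prod_(j <- r) wave (v j) (th j) xi) +
  2^-1 * \int[mu]_xi (wave (w - v i) (ph - th i) xi * \prod_(j <- r) wave (v j) (th j) xi).
Proof.
have b1 := bounded_measurable_wave_prod r v th (w + v i) (ph + th i).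
have b2 := bounded_measurable_wave_prod r v th (w - v i) (ph - th i).
rewrite -(haar_integralZ _ b1) -(haar_integralZ _ b2).
rewrite -(haar_integralD (bounded_measurableZ _ b1) (bounded_measurableZ _ b2)).
apply: eq_Rintegral => xi _.
by rewrite big_cons mulrA waveM mulrDl !mulrA.
Qed.

(** Expanding the product into characters, every frequency that occurs is a
    signed sum; the signs that occur depend on the term, whence the quantification
    over all of them. *)
Lemma integral_wave_prod_eq0 (I : finType) (r : seq I) (v : I -> 'rV[int]_2)
    (th : I -> R) w ph : uniq r ->
  (forall s : {ffun I -> bool}, w + \sum_(i <- r) (-1) ^+ s i *: v i != 0) ->
  \int[mu]_xi (wave w ph xi * \prod_(i <- r) wave (v i) (th i) xi) = 0.
Proof.
elim: r w ph => [|i r IH] w ph.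
  move=> _ /(_ [ffun=> true]); rewrite big_nil addr0 => w0.
  under eq_Rintegral do rewrite big_nil mulr1.
  exact: haar_integral_wave.
move=> /andP[ir ur] wS; rewrite integral_wave_prod_cons.
have wS' (b : bool) : forall s : {ffun I -> bool},
    w + (-1) ^+ b *: v i + \sum_(j <- r) (-1) ^+ s j *: v j != 0.
  move=> s; have := wS [ffun j => if j == i then b else s j].
  rewrite big_cons ffunE eqxx addrA.
  congr (_ + _ != 0); apply: eq_big_seq => j jr; rewrite ffunE.
  by case: eqP jr ir => // -> ->.
rewrite !IH// ?mulr0 ?addr0//.
- by have := wS' true; rewrite expr1 scaleN1r.
- by have := wS' false; rewrite expr0 scale1r.
Qed.

(** All the terms of the expansion have nonnegative integral, and the term with
    all signs positive, of weight 2^-(size r), has integral 1 when the sum of the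
    frequencies vanishes. *)
Lemma integral_wave_prod_ge (I : Type) (r : seq I) (v : I -> 'rV[int]_2) w :
  0 <= \int[mu]_xi (wave w 0 xi * \prod_(i <- r) wave (v i) 0 xi) /\
  (w + \sum_(i <- r) v i = 0 ->
   2^-1 ^+ size r <= \int[mu]_xi (wave w 0 xi * \prod_(i <- r) wave (v i) 0 xi)).
Proof.
elim: r w => [|i r IH] w.
  rewrite big_nil addr0 expr0; under eq_Rintegral do rewrite big_nil mulr1.
  have [->|w0] := eqVneq w 0.
    by under eq_Rintegral do rewrite wave0; rewrite haar_integral_cst cos0.
  by rewrite haar_integral_wave//; split => // /eqP; rewrite (negbTE w0).
have := @integral_wave_prod_cons _ i r v (fun=> 0) w 0; rewrite !addr0 subr0 => ->.
have [p1 p2] := IH (w + v i); have [q1 q2] := IH (w - v i).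
split; first by rewrite addr_ge0// mulr_ge0.
rewrite big_cons addrA => /p2 h; rewrite exprS.
by apply: (le_trans (ler_wpM2l _ h)) => //; rewrite lerDl mulr_ge0.
Qed.

(** The condition on frequencies to which [jointly_mixing_seqP] reduces joint
    mixing. *)
Definition asymptotically_independent (K : nat) (S : 'I_K -> nat -> 'M[int]_2) :=
  forall m : 'I_K -> 'rV[int]_2, (exists i, m i != 0) ->
  \forall n \near \oo, \sum_(i < K) m i *m S i n != 0.

(** The signs produced by the expansion can be absorbed in the vectors m i, and
    there are finitely many choices of signs. *)
Lemma mixing_waves (K : nat) (S : 'I_K -> nat -> 'M[int]_2) m th :
  asymptotically_independent S ->
  \int[mu]_xi (\prod_(i < K) wave (m i) (th i) (torus_act (S i n) xi)) @[n --> \oo]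
    --> \prod_(i < K) \int[mu]_xi wave (m i) (th i) xi.
Proof.
move=> indep.
have [/existsP[i0 m0]|/existsPn m0] := boolP [exists i, m i != 0]; last first.
  have mE i : m i = 0 by have := m0 i; rewrite negbK => /eqP.
  apply: cvg_near_cst; apply: nearW => n.
  have -> : \prod_(i < K) \int[mu]_xi wave (m i) (th i) xi = \prod_(i < K) cos (th i).
    apply: eq_bigr => i _; rewrite mE.
    by under eq_Rintegral do rewrite wave0; rewrite haar_integral_cst.
  rewrite -[RHS]haar_integral_cst; apply: eq_Rintegral => xi _.
  by apply: eq_bigr => i _; rewrite mE wave0.
rewrite [X in _ --> X](bigD1 i0)//= haar_integral_wave// mul0r.
apply: cvg_near_cst.
have : \forall n \near \oo, forall s : {ffun 'I_K -> bool},
    \sum_(i < K) ((-1) ^+ s i *: m i) *m S i n != 0.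
  apply: filter_forall => s; apply: indep; exists i0.
  by rewrite scalemx_eq0 signr_eq0.
apply: filterS => n hn.
have := @integral_wave_prod_eq0 'I_K (index_enum 'I_K) (fun i => m i *m S i n) th 0 0
  (index_enum_uniq _).
move=> <-.
  apply: eq_Rintegral => xi _; rewrite wave0 cos0 mul1r.
  by apply: eq_bigr => i _; rewrite wave_act.
move=> s; rewrite add0r.
by under eq_bigr do rewrite scalemxAl; exact: hn.
Qed.

(** Induction on j, the number of leading functions allowed to be arbitrary
    while the others are characters. *)
Lemma mixing_bounded (K : nat) (S : 'I_K -> nat -> 'M[int]_2) :
  (forall i n, \det (S i n) = 1) -> asymptotically_independent S ->
  forall f : 'I_K -> torus R -> R, (forall i, bounded_measurable (f i)) ->
  \int[mu]_xi (\prod_(i < K) f i (torus_act (S i n) xi)) @[n --> \oo]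
    --> \prod_(i < K) \int[mu]_xi f i xi.
Proof.
move=> S1 indep.
suff mix j : forall f : 'I_K -> torus R -> R, (forall i, bounded_measurable (f i)) ->
    (forall i : 'I_K, (j <= i)%N -> exists m th, f i = wave m th) ->
    \int[mu]_xi (\prod_(i < K) f i (torus_act (S i n) xi)) @[n --> \oo]
      --> \prod_(i < K) \int[mu]_xi f i xi.
  by move=> f bf; apply: (mix K) => // i; rewrite leqNgt ltn_ord.
elim: j => [|j IH] f bf fw.
  have /choice[m] : forall i : 'I_K, exists m, exists th, f i = wave m th.
    by move=> i; apply: fw.
  move=> /choice[th fE].
  have -> : f = fun i => wave (m i) (th i) by apply/funext => i; exact: fE.
  exact: mixing_waves.
have [Kj|jK] := leqP K j.
  by apply: IH => // i ji; have := ltn_ord i; rewrite ltnNge (leq_trans Kj ji).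
pose i0 := Ordinal jK.
(* The product of the other functions is the uniformly bounded weight of
   mixing_monotone_class. *)
pose h n xi := \prod_(i < K | i != i0) f i (torus_act (S i n) xi).
have bh n : bounded_measurable (h n).
  by apply: bounded_measurable_prod => i; exact: bounded_measurable_act.
have /choice[M fM] : forall i, exists M, forall xi, `|f i xi| <= M.
  by move=> i; case: (bf i).
have split_prod (g : 'I_K -> torus R -> R) : (forall i, i != i0 -> g i = f i) ->
    (fun n => \int[mu]_xi (\prod_(i < K) g i (torus_act (S i n) xi))) =
    (fun n => \int[mu]_xi (g i0 (torus_act (S i0 n) xi) * h n xi)).
  move=> gf; apply/funext => n; apply: eq_Rintegral => xi _.
  by rewrite (bigD1 i0)//=; congr (_ * _); apply: eq_bigr => i ii0; rewrite gf.
rewrite split_prod// (bigD1 i0)//=.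
apply: (@mixing_monotone_class R (S i0) h (\prod_(i < K | i != i0) M i)) => //.
- by move=> n; case: (bh n).
- move=> n xi; rewrite /h normr_prod; apply: ler_prod => i _.
  by rewrite normr_ge0 fM.
- move=> m th.
  pose g i := if i == i0 then wave m th else f i.
  have gf i : i != i0 -> g i = f i by rewrite /g => /negbTE ->.
  have g0 : g i0 = wave m th by rewrite /g eqxx.
  have cE : \prod_(i < K | i != i0) \int[mu]_xi g i xi =
      \prod_(i < K | i != i0) \int[mu]_xi f i xi.
    by apply: eq_bigr => i /gf ->.
  have := IH g; rewrite (split_prod g gf) (bigD1 i0)//= g0 cE.
  apply.
  + by move=> i; rewrite /g; case: ifP => // _; exact: bounded_measurable_wave.
  + move=> i ji; rewrite /g; case: eqVneq => [_|ii0]; first by exists m, th.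
    apply: fw; rewrite ltn_neqAle ji andbT.
    by apply: contra_neq ii0 => ji'; exact/val_inj.
Qed.

(** The inverse image of a null set is null, by invariance of the measure. *)
Lemma ae_torus_act (T : 'M[int]_2) (P : torus R -> Prop) : \det T = 1 ->
  {ae mu, forall xi, P xi} -> {ae mu, forall xi, P (torus_act T xi)}.
Proof.
move=> T1 [N [mN N0 PN]].
have mTN : measurable (@torus_act R T @^-1` N).
  by rewrite -[X in measurable X]setTI; exact: measurable_torus_act.
exists (@torus_act R T @^-1` N); split; [exact: mTN | | by move=> xi /= /PN].
have muE (A : set (torus R)) : measurable A -> \int[mu]_xi \1_A xi = fine (@haar_torus R A).
  by move=> mA; rewrite /Rintegral (integral_indic _ measurableT mA) setIT.
have h : fine (@haar_torus R (@torus_act R T @^-1` N)) = fine (@haar_torus R N).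
  rewrite -!muE// -(haar_integral_act T1 (bounded_measurable_indic mN)).
  apply: eq_Rintegral => xi _.
  by rewrite !indicE; congr (_%:R); apply/idP/idP; rewrite !inE.
have N0' : fine (@haar_torus R N) = 0 := congr1 fine N0.
apply: (@eq_trans _ _ (fine (@haar_torus R (@torus_act R T @^-1` N)))%:E).
  by apply/esym/fineK; exact: fin_num_measure.
by rewrite h N0'.
Qed.

Lemma haarT_gt0 : (0 < [the {measure set _ -> \bar R} of mu] [set: torus R])%E.
Proof. by apply: lt_le_trans lte01 _; rewrite le_eqVlt; apply/orP; left; apply/eqP/esym/haarT. Qed.

Lemma Lfun_ae_bounded (f : torus R -> R) : f \in Lfun mu +oo%E ->
  exists2 g, bounded_measurable g & {ae mu, forall xi, f xi = g xi}.
Proof.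
move=> /andP[]; rewrite !inE => mf; rewrite /= /finite_norm unlock /Lnorm.
rewrite ifT => [fty|]; last exact: haarT_gt0.
have [M [M0 fM]] : exists M : R, 0 <= M /\ {ae mu, forall xi, `|f xi| <= M}.
  have := ess_sup_ge mu (abse \o (EFin \o f)).
  case: (ess_sup _ _) fty => [r _|//|_] h.
  - exists `|r|; split => //; apply: filterS h => xi /=; rewrite lee_fin => h.
    exact: le_trans h (ler_norm _).
  - by exists 0; split => //; apply: filterS h => xi /=; rewrite leeNy_eq.
exists (fun xi => Num.max (- M) (Num.min M (f xi))).
  split.
    by apply: measurable_maxr => //; apply: measurable_minr.
  exists M => xi; rewrite ler_norml le_max lexx /= ge_max ge_min lexx /=.
  by rewrite (le_trans _ M0)// oppr_le0.
apply: filterS fM => xi; rewrite ler_norml => /andP[h1 h2].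
by rewrite (min_idPr h2) (max_idPr h1).
Qed.

Lemma bounded_Lfun (f : torus R -> R) : bounded_measurable f -> f \in Lfun mu +oo%E.
Proof.
move=> [mf [M fM]]; apply/andP; split; rewrite inE //.
rewrite /= /finite_norm unlock /Lnorm ifT; last exact: haarT_gt0.
apply: (@le_lt_trans _ _ M%:E); last exact: ltry.
by apply/ess_supP; apply: aeW => xi /=; rewrite lee_fin.
Qed.

(** The last function of the definition of joint mixing is not moved: this
    treats it as moved by the identity matrix, so that all k + 1 functions play
    the same role. *)
Definition with_identity (k : nat) (T : 'I_k -> nat -> 'M[int]_2)
    (i : 'I_k.+1) (n : nat) : 'M[int]_2 :=
  if unlift ord_max i is Some j then T j n else 1%:M.

Lemma widen_ord_max k (i : 'I_k) : widen_ord (leqnSn k) i = lift ord_max i.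
Proof. by apply: val_inj; rewrite /= /bump leqNgt ltn_ord. Qed.

Lemma with_identity_widen k (T : 'I_k -> nat -> 'M[int]_2) i n :
  with_identity T (widen_ord (leqnSn k) i) n = T i n.
Proof. by rewrite widen_ord_max /with_identity liftK. Qed.

Lemma with_identity_max k (T : 'I_k -> nat -> 'M[int]_2) n :
  with_identity T ord_max n = 1%:M.
Proof. by rewrite /with_identity unlift_none. Qed.

Lemma torus_act1 (xi : torus R) : torus_act 1%:M xi = xi.
Proof.
rewrite /torus_act -[RHS]reprK; congr (\pi_(_) _); rewrite /plane_act !mxE /=.
by case: (repr xi) => a b /=; rewrite !mul1r !mul0r addr0 add0r.
Qed.

Lemma jointly_mixing_seqE k (T : 'I_k -> nat -> 'M[int]_2) (f : 'I_k.+1 -> torus R -> R) n xi :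
  (\prod_(i < k) f (widen_ord (leqnSn k) i) (torus_act (T i n) xi)) * f ord_max xi =
  \prod_(i < k.+1) f i (torus_act (with_identity T i n) xi).
Proof.
rewrite big_ord_recr /= with_identity_max torus_act1; congr (_ * _).
by apply: eq_bigr => i _; rewrite with_identity_widen.
Qed.

(** A relation recurring for arbitrarily large n keeps the integral of a product
    of cosines above a fixed positive number, whereas the product of the
    integrals is 0. *)
Theorem jointly_mixing_seqP k (T : 'I_k -> nat -> 'M[int]_2) :
  (forall i n, \det (T i n) = 1) ->
  jointly_mixing_seq R T <-> asymptotically_independent (with_identity T).
Proof.
move=> T1.
have S1 i n : \det (with_identity T i n) = 1.
  by rewrite /with_identity; case: unlift => // ; rewrite det1.
split=> [mix m [i0 m0]|indep f Lf]; last first.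
- have /choice[g gP] : forall i, exists g, bounded_measurable g /\
      {ae mu, forall xi, f i xi = g xi}.
    by move=> i; have [g] := Lfun_ae_bounded (Lf i); exists g.
  have -> : \prod_(i < k.+1) \int[mu]_xi f i xi = \prod_(i < k.+1) \int[mu]_xi g i xi.
    apply: eq_bigr => i _; congr fine; apply: ae_eq_integral => //.
    + by apply/measurable_EFinP; have := Lf i; rewrite inE => /andP[/[!inE]].
    + by apply/measurable_EFinP; case: (gP i) => -[].
    + by case: (gP i) => _; apply: filterS => xi /= ->.
  have mf i : measurable_fun setT (f i).
    by have := Lf i; rewrite inE => /andP[/[!inE]].
  rewrite (_ : (fun n => _) = fun n =>
    \int[mu]_xi \prod_(i < k.+1) g i (torus_act (with_identity T i n) xi)).
    by apply: mixing_bounded => // i; case: (gP i).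
  apply/funext => n; congr fine; apply: ae_eq_integral => //.
  + apply/measurable_EFinP.
    rewrite (_ : (fun xi => _) = fun xi =>
        \prod_(i < k.+1) f i (torus_act (with_identity T i n) xi)); last first.
      by apply/funext => xi; exact: jointly_mixing_seqE.
    apply: measurable_prod => i _.
    exact: measurableT_comp (mf i) (@measurable_torus_act R _).
  + apply/measurable_EFinP.
    have [] // : bounded_measurable (fun xi =>
      \prod_(i < k.+1) g i (torus_act (with_identity T i n) xi)).
    by apply: bounded_measurable_prod => i; apply: bounded_measurable_act; case: (gP i).
  + have : {ae mu, forall xi, forall i, f i (torus_act (with_identity T i n) xi) =
        g i (torus_act (with_identity T i n) xi)}.
      apply: filter_forall => i; apply: (ae_torus_act (P := fun xi => f i xi = g i xi)) => //.
      by case: (gP i).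
    apply: filterS => xi hxi _; congr EFin; rewrite (jointly_mixing_seqE T f n xi).
    by apply: eq_bigr => i _.
- apply: contrapT => nindep.
  have := mix (fun i => wave (m i) 0) (fun i => bounded_Lfun (bounded_measurable_wave _ _)).
  rewrite [X in _ --> X](bigD1 i0)//= haar_integral_wave// mul0r.
  have e0 : 0 < 2^-1 ^+ k.+1 :> R by rewrite exprn_gt0.
  move=> /cvgrPdist_lt/(_ _ e0) h; apply: nindep; apply: filterS h => n.
  rewrite sub0r normrN; apply: contraTneq => mS0.
  rewrite -leNgt.
  have [_ ge] := @integral_wave_prod_ge _ (index_enum 'I_k.+1)
    (fun i => m i *m with_identity T i n) 0.
  have sizeK : size (index_enum ('I_k.+1)) = k.+1.
    by rewrite -[RHS]card_ord cardT enumT.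
  rewrite sizeK add0r in ge.
  apply: le_trans (ler_norm _).
  apply: le_trans (ge mS0) _.
  rewrite le_eqVlt; apply/orP; left; apply/eqP; apply: eq_Rintegral => xi _.
  rewrite (jointly_mixing_seqE T (fun i => wave (m i) 0) n xi) wave0 cos0 mul1r.
  by apply: eq_bigr => i _; rewrite wave_act.
Qed.

End criterion.

(** * Eigenvalues and traces *)

Section eigenvalues.
Local Open Scope ring_scope.
Variable R : realType.

Lemma complex_eigenvalueE (T : 'M[int]_2) (z : R[i]) : \det T = 1 ->
  complex_eigenvalue T z = (z ^+ 2 - (\tr T)%:~R * z + 1 == 0).
Proof.
by move=> T1; rewrite /complex_eigenvalue eigenvalue_mx22 ?map_mx_det1// map_mx_trace.
Qed.

(** The roots of X^2 - t X + 1 are real, or conjugate of product 1 and hence on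
    the unit circle. *)
Lemma complex_root_cases (t a b : R) :
  ((a +i* b)%C ^+ 2 - t%:C%C * (a +i* b)%C + 1 == 0) ->
  (b = 0 /\ a ^+ 2 - t * a + 1 = 0) \/ (t = 2 * a /\ a ^+ 2 + b ^+ 2 = 1).
Proof.
rewrite expr2 eq_complex /= => /andP[/eqP re /eqP im].
have : b * (2 * a - t) = 0.
  by apply/eqP; rewrite -im; apply/eqP; ring.
move=> /eqP; rewrite mulf_eq0 => /orP[/eqP b0|/eqP at0]; [left|right].
- by split => //; move: re; rewrite b0 => <-; ring.
- have tE : t = 2 * a by lra.
  by split => //; move: re; rewrite tE; lra.
Qed.

Lemma norm_complex_eq (a b r : R) : 0 <= r ->
  (`|(a +i* b)%C| = r%:C%C) <-> a ^+ 2 + b ^+ 2 = r ^+ 2.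
Proof.
move=> r0; rewrite normc_def /=; split.
  by move=> /complexI <-; rewrite sqr_sqrtr// addr_ge0// sqr_ge0.
by move=> ->; rewrite sqrtr_sqr ger0_norm.
Qed.

Lemma intr_complex (n : int) : n%:~R = (n%:~R : R)%:C%C.
Proof. by rewrite rmorph_int. Qed.

Lemma not_hyperbolic_trace (T : 'M[int]_2) : \det T = 1 ->
  ~ hyperbolic R T -> `|\tr T| <= 2.
Proof.
move=> T1 /existsNP[[a b]] /not_implyP[]; rewrite complex_eigenvalueE// intr_complex.
move=> /complex_root_cases rt /negP; rewrite negbK => /eqP.
rewrite -[1 in X in X -> _]/((1 : R)%:C%C) => /(norm_complex_eq _ _ ler01) n1.
suff : `|(\tr T)%:~R : R| <= 2 by rewrite -intr_norm (_ : 2 = 2%:~R)// ler_int.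
rewrite expr1n in n1; rewrite ler_norml; case: rt => [[b0 ra]|[-> _]]; last first.
  have a1 : `|a| <= 1.
    by rewrite -(ler_sqr (x := `|a|)) ?nnegrE// real_normK ?num_real// expr1n -n1 lerDl sqr_ge0.
  by move: a1; rewrite ler_norml => /andP[? ?]; apply/andP; split; lra.
have : (a - 1) * (a + 1) = 0 by move: n1; rewrite b0; lra.
move=> /eqP; rewrite mulf_eq0 => /orP[/eqP ha|/eqP ha].
  have aE : a = 1 by lra.
  by rewrite aE in ra; apply/andP; split; lra.
have aE : a = -1 by lra.
by rewrite aE in ra; apply/andP; split; lra.
Qed.

Lemma hyperbolic_trace (T : 'M[int]_2) : \det T = 1 ->
  hyperbolic R T -> 2 < `|(\tr T)%:~R : R|.
Proof.
move=> T1 hyp; rewrite ltNge; apply/negP => t2.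
set t : R := _%:~R in t2.
have t4 : t ^+ 2 <= 4 by have := normr_ge0 t; rewrite -(real_normK (num_real t)); nra.
pose s := Num.sqrt (1 - (t / 2) ^+ 2).
have s2 : s ^+ 2 = 1 - (t / 2) ^+ 2 by rewrite sqr_sqrtr//; lra.
have := hyp (t / 2 +i* s)%C; rewrite complex_eigenvalueE// intr_complex -/t.
have -> : `|(t / 2 +i* s)%C| = 1.
  by rewrite -[RHS]/((1 : R)%:C%C); apply/norm_complex_eq => //; rewrite s2; lra.
rewrite eqxx => /(_ _)/negP; apply => //.
rewrite expr2 eq_complex /=; apply/andP; split; apply/eqP; first by move: s2; lra.
by field.
Qed.

Lemma real_expanding_root (t : R) : 2 < `|t| ->
  exists lam : R, 1 < `|lam| /\ lam ^+ 2 - t * lam + 1 = 0.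
Proof.
move=> t2; have t4 : 4 < t ^+ 2 by rewrite -(real_normK (num_real t)); nra.
pose s := Num.sqrt (t ^+ 2 - 4).
have s2 : s ^+ 2 = t ^+ 2 - 4 by rewrite sqr_sqrtr//; lra.
have s0 : 0 <= s := sqrtr_ge0 _.
have [t0|t0] := leP 0 t.
  exists ((t + s) / 2); split; last by move: s2; lra.
  by rewrite ger0_norm in t2 => //; rewrite ger0_norm; lra.
exists ((t - s) / 2); split; last by move: s2; lra.
by rewrite ltr0_norm in t2 => //; rewrite ltr0_norm; lra.
Qed.

Lemma has_eigenvalue_of_modulusP (T : 'M[int]_2) (lam : R) : \det T = 1 ->
  lam ^+ 2 - (\tr T)%:~R * lam + 1 = 0 -> has_eigenvalue_of_modulus `|lam| T.
Proof.
move=> T1 rt; exists (lam%:C)%C.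
  rewrite complex_eigenvalueE// intr_complex expr2 eq_complex /=.
  by apply/andP; split; apply/eqP; [move: rt; rewrite expr2; lra|ring].
by apply/norm_complex_eq => //; rewrite real_normK ?num_real// expr0n/= addr0.
Qed.

Lemma modulus_trace (T : 'M[int]_2) (rho : R) : \det T = 1 -> 1 < rho ->
  has_eigenvalue_of_modulus rho T -> (\tr T)%:~R ^+ 2 = (rho + rho^-1) ^+ 2.
Proof.
move=> T1 r1 [[a b]]; rewrite complex_eigenvalueE// intr_complex.
move=> /complex_root_cases rt /norm_complex_eq nr.
have {}nr : a ^+ 2 + b ^+ 2 = rho ^+ 2 by apply: nr; lra.
case: rt => [[b0 ra]|[_ h]]; last by nra.
rewrite b0 expr0n/= addr0 in nr.
have r0 : rho != 0 by rewrite gt_eqF//; lra.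
have a0 : a != 0.
  by apply: contra_neq r0 => a0; apply/eqP; rewrite -sqrf_eq0 -nr a0 expr0n.
have -> : (\tr T)%:~R = a + a^-1.
  by apply: (mulIf a0); rewrite mulrDl mulVf//; lra.
by rewrite !sqrrD !exprVn nr !divff.
Qed.

End eigenvalues.

(** * Integer vectors under a hyperbolic matrix *)

Section integer_vectors.
Local Open Scope classical_set_scope.
Local Open Scope ring_scope.
Variable R : realType.
Notation "M ^R" := (map_mx intr M : 'M[R]_(_, _)) (at level 2, format "M ^R").

(** The integer vectors p T^n = x^n p tend to 0, so one of them vanishes. *)
Lemma no_contracted_int_vector (T : 'M[int]_2) (p : 'rV[int]_2) (x : R) :
  \det T = 1 -> `|x| < 1 -> p^R *m T^R = x *: p^R -> p = 0.
Proof.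
move=> T1 x1 pT.
have pTn n : (p *m T ^+ n)^R = x ^+ n *: p^R.
  elim: n => [|n IH]; first by rewrite expr0 mulmx1 scale1r.
  by rewrite exprSr -mulmxE mulmxA map_mxM IH -scalemxAl pT scalerA exprSr.
have : \forall n \near \oo, forall j, `|x ^+ n * p^R 0 j| < 1.
  apply: filter_forall => j.
  have : x ^+ n * p^R 0 j @[n --> \oo] --> 0 * p^R 0 j.
    by apply: cvgM; [exact: cvg_expr | exact: cvg_cst].
  rewrite mul0r => /cvgrPdist_lt/(_ _ ltr01); apply: filterS => n.
  by rewrite sub0r normrN.
move=> /(@filter_ex _ _ _)[n hn].
suff : p *m T ^+ n = 0 by move/eqP; rewrite mulmx_det1_eq0 ?detX ?T1 ?expr1n// => /eqP.
apply/rowP => j; rewrite [RHS]mxE; apply/eqP.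
have := hn j; have /matrixP/(_ 0 j) := pTn n; rewrite [LHS]mxE [RHS]mxE => <-.
rewrite -intr_norm (_ : 1 = 1%:~R)// ltr_int => h.
by rewrite -normr_le0 -ltzD1 add0r.
Qed.

(** Apply [no_contracted_int_vector] to the inverse of T, which is tr T - T. *)
Lemma no_int_eigenvector (T : 'M[int]_2) (p : 'rV[int]_2) (x : R) :
  \det T = 1 -> 1 < `|x| -> x ^+ 2 - (\tr T)%:~R * x + 1 = 0 ->
  p^R *m T^R = x *: p^R -> p = 0.
Proof.
move=> T1 x1 rt pT.
have x0 : x != 0 by rewrite -normr_gt0 (lt_trans ltr01).
pose T' := (\tr T)%:M - T.
have T'1 : \det T' = 1.
  by rewrite -T1 !det_mx22 !mxE mxtrace22 /= mulr1n mulr0n; ring.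
apply: (@no_contracted_int_vector T' p x^-1) => //.
  by rewrite normfV invf_lt1// (lt_trans ltr01).
rewrite map_mxB map_scalar_mx mulmxBr pT mul_mx_scalar -scalerBl; congr (_ *: _).
by apply: (mulIf x0); rewrite mulVf// mulrBl; lra.
Qed.

(** A nonzero integer matrix of which u is a left null vector has rank one; u is
    orthogonal to a nonzero column, hence proportional to that column turned by
    a right angle. *)
Lemma rational_eigenvector (T D : 'M[int]_2) (u : 'rV[R]_2) (x : R) :
  u != 0 -> D != 0 -> u *m D^R = 0 -> u *m T^R = x *: u ->
  exists2 p : 'rV[int]_2, p != 0 & p^R *m T^R = x *: p^R.
Proof.
move=> u0 D0 uD uT.
have [j Dj] : exists j, (D 0 j != 0) || (D 1 j != 0).
  apply/existsP; apply: contra_neqT D0 => /existsPn h; apply/matrixP => i j.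
  have := h j; rewrite negb_or !negbK => /andP[/eqP h0 /eqP h1].
  by rewrite mxE; elim/(@ord2_cases) : i.
have uDj : u 0 0 * (D 0 j)%:~R + u 0 1 * (D 1 j)%:~R = 0.
  by have /rowP/(_ j) := uD; rewrite !mxE sum_ord2 !mxE.
pose p : 'rV[int]_2 := \row_a if a == 0 then D 1 j else - D 0 j.
have p0 : p 0 0 = D 1 j by rewrite mxE.
have p1 : p 0 1 = - D 0 j by rewrite mxE.
have pu a : (p 0 a)%:~R *: u = u 0 a *: p^R.
  apply/rowP; elim/(@ord2_cases); elim/(@ord2_cases) : a;
    rewrite ![LHS]mxE ![RHS]mxE ![map_mx _ _ _ _]mxE ?p0 ?p1 ?rmorphN /= ; lra.
exists p.
  apply: contraTneq Dj => p00; rewrite negb_or !negbK.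
  by rewrite -p0 -[D 0 j]opprK -p1 p00 !mxE oppr0 eqxx.
have [a ua] : exists a, u 0 a != 0 by apply/rV0Pn.
have -> : p^R = ((p 0 a)%:~R / u 0 a) *: u.
  by rewrite mulrC -scalerA pu scalerA mulVf// scale1r.
by rewrite -scalemxAl uT !scalerA mulrC.
Qed.

(** With mu = 1 / lam, the vectors u = m (T - mu) / (lam - mu) and
    w = m (T - lam) / (lam - mu) are eigenvectors by the theorem of
    Cayley-Hamilton, and m = u - w.  If u were zero, m would be an eigenvector for
    mu, which is impossible for a nonzero integer vector. *)
Lemma expanding_component (T : 'M[int]_2) (lam : R) (m : 'rV[int]_2) :
  \det T = 1 -> 1 < `|lam| -> lam ^+ 2 - (\tr T)%:~R * lam + 1 = 0 ->
  exists u w : 'rV[R]_2, [/\ u *m T^R = lam *: u,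
    forall n, (m *m T ^+ n)^R = lam ^+ n *: u - lam^-1 ^+ n *: w &
    m != 0 -> u != 0].
Proof.
move=> T1 l1 rt.
have l0 : lam != 0 by rewrite -normr_gt0 (lt_trans ltr01).
have tE : (\tr T)%:~R = lam + lam^-1.
  by apply: (mulIf l0); rewrite mulrDl mulVf//; lra.
have d0 : lam - lam^-1 != 0.
  rewrite subr_eq0; apply: contraTneq l1 => /(congr1 Num.norm); rewrite normfV => h.
  have : `|lam| ^+ 2 = 1 by rewrite expr2 {1}h mulVf// normr_eq0.
  by rewrite -leNgt => h2; have := normr_ge0 lam; nra.
have T2 : T^R *m T^R = (lam + lam^-1) *: T^R - 1%:M.
  by rewrite mulmx_det1 ?map_mx_det1// map_mx_trace tE.
pose c := (lam - lam^-1)^-1.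
pose u := c *: (m^R *m T^R - lam^-1 *: m^R).
pose w := c *: (m^R *m T^R - lam *: m^R).
have mTT : m^R *m T^R *m T^R = (lam + lam^-1) *: (m^R *m T^R) - m^R.
  by rewrite -mulmxA T2 mulmxBr -scalemxAr mulmx1.
have uT : u *m T^R = lam *: u.
  rewrite /u -scalemxAl mulmxBl mTT -scalemxAl scalerA mulrC -scalerA; congr (_ *: _).
  rewrite scalerBr !scalerA mulfV// scale1r scalerDl addrAC; congr (_ - _).
  by rewrite -addrA subrr addr0.
have wT : w *m T^R = lam^-1 *: w.
  rewrite /w -scalemxAl mulmxBl mTT -scalemxAl scalerA mulrC -scalerA; congr (_ *: _).
  rewrite scalerBr !scalerA mulVf// scale1r scalerDl addrAC; congr (_ - _).
  by rewrite addrC addKr.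
have uw : m^R = u - w.
  rewrite /u /w -scalerBr opprB addrC addrA subrK.
  by rewrite -scalerBl scalerA mulVf// scale1r.
have u_neq0 : m != 0 -> u != 0.
  apply: contraNneq => u0; apply/eqP/(@no_contracted_int_vector T m lam^-1) => //.
    by rewrite normfV invf_lt1// (lt_trans ltr01).
  apply/eqP; rewrite -subr_eq0; move/eqP : u0; rewrite scalemx_eq0 => /orP[|//].
  by rewrite invr_eq0 (negbTE d0).
clearbody u w; exists u, w; split => //.
elim=> [|n IH]; first by rewrite !expr0 !scale1r mulmx1.
rewrite exprSr -mulmxE mulmxA.
have -> : (m *m T ^+ n *m T)^R = (m *m T ^+ n)^R *m T^R by exact: map_mxM.
by rewrite IH mulmxBl -!scalemxAl uT wT !scalerA -!exprSr.
Qed.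

End integer_vectors.

(** * Relations between powers *)

Section arithmetic.
Local Open Scope classical_set_scope.
Local Open Scope ring_scope.
Variable R : realType.
Notation "M ^R" := (map_mx intr M : 'M[R]_(_, _)) (at level 2, format "M ^R").

(** One of T1 - T0 and T1 + T0 annihilates u; if it were nonzero, T0 would have
    an integer eigenvector by [rational_eigenvector]. *)
Lemma common_expanding_vector (T0 T1 : 'M[int]_2) (lam0 lam1 : R) (u : 'rV[R]_2) :
  \det T0 = 1 -> 1 < `|lam0| -> lam0 ^+ 2 - (\tr T0)%:~R * lam0 + 1 = 0 ->
  `|lam1| = `|lam0| -> u != 0 -> u *m T0^R = lam0 *: u -> u *m T1^R = lam1 *: u ->
  T1 = T0 \/ T1 = - T0.
Proof.
move=> T01 l0 rt l10 u0 uT0 uT1.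
have noD (D : 'M[int]_2) : u *m D^R = 0 -> D = 0.
  move=> uD; apply/eqP; apply: contraT => D0.
  have [p p0 pT] := rational_eigenvector u0 D0 uD uT0.
  by move: p0; rewrite (no_int_eigenvector T01 l0 rt pT) eqxx.
have : lam1 ^+ 2 == lam0 ^+ 2.
  by rewrite -(real_normK (num_real lam1)) l10 real_normK// num_real.
rewrite eqf_sqr => /orP[/eqP ll|/eqP ll]; [left|right].
- apply/eqP; rewrite -subr_eq0; apply/eqP/noD.
  by rewrite map_mxB mulmxBr uT1 uT0 ll subrr.
- apply/eqP; rewrite -subr_eq0 opprK; apply/eqP/noD.
  by rewrite map_mxD mulmxDr uT1 uT0 ll scaleNr addNr.
Qed.

Lemma sum_with_identity k (T : 'I_k -> nat -> 'M[int]_2) (m : 'I_k.+1 -> 'rV[int]_2) n :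
  \sum_(i < k.+1) m i *m with_identity T i n =
  \sum_(i < k) m (widen_ord (leqnSn k) i) *m T i n + m ord_max.
Proof.
rewrite big_ord_recr /= with_identity_max mulmx1; congr (_ + _).
by apply: eq_bigr => i _; rewrite with_identity_widen.
Qed.

Lemma expr_odd_norm1 (x : R) n : `|x| = 1 -> x ^+ n = x ^+ odd n.
Proof.
move=> x1; rewrite -[in LHS](odd_double_half n) exprD -muln2 mulnC exprM.
by rewrite -(real_normK (num_real x)) x1 !expr1n mulr1.
Qed.

Lemma cvg_geometric0 (x c : R) : `|x| < 1 -> x ^+ n * c @[n --> \oo] --> 0.
Proof.
by move=> x1; rewrite -(mul0r c); apply: cvgM; [exact: cvg_expr|exact: cvg_cst].
Qed.

Lemma cvg0D (f g : nat -> R) : f n @[n --> \oo] --> 0 -> g n @[n --> \oo] --> 0 ->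
  f n + g n @[n --> \oo] --> 0.
Proof. by move=> f0 g0; rewrite -(addr0 0); exact: cvgD. Qed.

Lemma cvg_sum0 (I : Type) (r : seq I) (P : pred I) (F : I -> nat -> R) :
  (forall i, P i -> F i n @[n --> \oo] --> 0) ->
  \sum_(i <- r | P i) F i n @[n --> \oo] --> 0.
Proof.
move=> F0; elim: r => [|i r IH].
  by under eq_fun do rewrite big_nil; exact: cvg_cst.
under eq_fun do rewrite big_cons.
case Pi : (P i) => //.
exact: cvg0D (F0 i Pi) IH.
Qed.

Lemma mem_asbool_pred (I : finType) (P : I -> Prop) i :
  (i \in [pred j | `[< P j >]]) = `[< P i >].
Proof. by []. Qed.

(** Divided by rho^n, with rho the largest modulus involved, the sum approaches
    [lead], which depends on n only through its parity, because lam i / rho is 1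
    or -1 for the indices that contribute.  It remains to see that neither of the
    two values of [lead] is zero. *)
Lemma asymptotically_independent_powers k (T : 'I_k -> 'M[int]_2) :
  (forall i, \det (T i) = 1) -> (forall i, hyperbolic R (T i)) ->
  (forall i j, i != j -> T i <> T j /\ T i <> - T j) ->
  (forall rho : R, 1 < rho ->
    (#|[pred i : 'I_k | `[< has_eigenvalue_of_modulus rho (T i) >]]| <= 2)%N) ->
  asymptotically_independent (with_identity (fun i n => T i ^+ n)).
Proof.
move=> T1 hyp neqT card2 m [i m_i0].
pose mk i := m (widen_ord (leqnSn k) i).
suff : \forall n \near \oo, \sum_(i < k) mk i *m T i ^+ n + m ord_max != 0.
  by apply: filterS => n; rewrite sum_with_identity.
have [/existsP[i00 m00]|/existsPn mk0] := boolP [exists i, mk i != 0]; last first.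
  apply: nearW => n; rewrite big1 ?add0r; last first.
    by move=> j _; have := mk0 j; rewrite negbK /mk => /eqP ->; rewrite mul0mx.
  case: (unliftP ord_max i) m_i0 => [j ->|->//].
  by rewrite -widen_ord_max; have := mk0 j; rewrite negbK /mk => /eqP ->; rewrite eqxx.
have /choice[lam lamP] : forall i, exists lam : R,
    1 < `|lam| /\ lam ^+ 2 - (\tr (T i))%:~R * lam + 1 = 0.
  by move=> j; apply: real_expanding_root; exact: hyperbolic_trace.
have lam1 j : 1 < `|lam j| by case: (lamP j).
have lamrt j := (lamP j).2.
have /choice[u] : forall i, exists u, exists w : 'rV[R]_2, [/\ u *m (T i)^R = lam i *: u,
    forall n, (mk i *m T i ^+ n)^R = lam i ^+ n *: u - (lam i)^-1 ^+ n *: w &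
    mk i != 0 -> u != 0].
  by move=> j; exact: expanding_component.
move=> /choice[w uw].
pose i0 := [arg max_(i > i00 | mk i != 0) `|lam i|]%O.
have [m0 lam_max] : mk i0 != 0 /\ forall j, mk j != 0 -> `|lam j| <= `|lam i0|.
  by rewrite /i0; case: arg_maxP.
pose rho := `|lam i0|.
have rho1 : 1 < rho by exact: lam1.
have rho0 : 0 < rho by exact: lt_trans rho1.
(* The indices whose contribution is not killed by the division by rho^n. *)
pose top j := (mk j != 0) && (`|lam j| == rho).
pose s (b : bool) j := (lam j / rho) ^+ b.
have top_norm j : top j -> `|lam j / rho| = 1.
  by move=> /andP[_ /eqP lj]; rewrite normrM lj normfV gtr0_norm// divff// gt_eqF.
have s0 b j : s b j != 0.
  rewrite expf_neq0// mulf_neq0 ?invr_eq0 ?(gt_eqF rho0)//.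
  by rewrite -normr_gt0 (lt_trans ltr01).
pose lead b := \sum_(j | top j) s b j *: u j.
have lead0 b : lead b != 0.
  apply/eqP; rewrite /lead (bigD1 i0) /=; last by rewrite /top m0 eqxx.
  have u0 : u i0 != 0 by case: (uw i0) => _ _; apply.
  have [/existsP[i1 /andP[top1 i10]]|/existsPn no1] :=
      boolP [exists j, top j && (j != i0)]; last first.
    rewrite big_pred0 ?addr0; last by move=> j; apply/negbTE/no1.
    by move/eqP; rewrite scalemx_eq0 (negbTE (s0 _ _)) (negbTE u0).
  rewrite (bigD1 i1) ?top1//= big1 ?addr0; last first.
    move=> i2 /andP[/andP[top2 i20] i21]; exfalso.
    (* A third contributing matrix would be one too many with eigenvalue of
       modulus rho. *)
    have := card2 _ rho1; rewrite leqNgt => /negP; apply; apply/card_gt2P.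
    exists i0, i1, i2; split; last by split; rewrite // eq_sym.
    have mem j : `|lam j| = rho ->
        j \in [pred i : 'I_k | `[< has_eigenvalue_of_modulus rho (T i) >]].
      move=> lj; rewrite mem_asbool_pred; apply/asboolP; rewrite -lj.
      exact: has_eigenvalue_of_modulusP (T1 j) (lamrt j).
    by split; apply: mem => //; [case/andP: top1 => _ /eqP|case/andP: top2 => _ /eqP].
  move=> /eqP; rewrite addr_eq0 => /eqP su.
  have u0E : u i0 = (- (s b i0)^-1 * s b i1) *: u i1.
    apply: (@scalemx_inj _ _ _ _ (s0 b i0)); rewrite su scalerA mulrA mulrN mulfV//.
    by rewrite mulN1r scaleNr.
  have uT1 : u i0 *m (T i1)^R = lam i1 *: u i0.
    by rewrite u0E -scalemxAl; case: (uw i1) => -> _ _; rewrite !scalerA mulrC.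
  have uT0 : u i0 *m (T i0)^R = lam i0 *: u i0 by case: (uw i0).
  have l10 : `|lam i1| = `|lam i0| by case/andP: top1 => _ /eqP.
  have [h1 h2] := neqT _ _ i10.
  by case: (common_expanding_vector (T1 i0) (lam1 i0) (lamrt i0) l10 u0 uT0 uT1).
pose total n := \sum_(i < k) mk i *m T i ^+ n + m ord_max.
(* The difference between the normalized sum and its leading part: slower
   expanding terms, contracting terms and the constant term. *)
pose rest n j := (total n)^R 0 j / rho ^+ n - lead (odd n) 0 j.
have totalE n j : (total n)^R 0 j =
    \sum_(i | mk i != 0) (mk i *m T i ^+ n)^R 0 j + (m ord_max)^R 0 j.
  rewrite !mxE rmorphD /= summxE rmorph_sum /=; congr (_ + _).
  rewrite (bigID (fun i => mk i != 0)) /= [X in _ + X]big1 ?addr0.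
    by apply: eq_bigr => a _; rewrite [RHS]mxE.
  by move=> a; rewrite negbK => /eqP ->; rewrite mul0mx mxE.
have restE n j : rest n j =
    \sum_(i | mk i != 0) ((if `|lam i| == rho then 0 else (lam i / rho) ^+ n * u i 0 j)
      - ((lam i)^-1 / rho) ^+ n * w i 0 j) + rho^-1 ^+ n * (m ord_max)^R 0 j.
  rewrite /rest totalE mulrDl addrAC exprVn [_^-1 * _]mulrC; congr (_ + _).
  rewrite /lead summxE /top big_mkcondr /= mulr_suml -sumrB; apply: eq_bigr => a ma.
  case: (uw a) => _ -> _; rewrite !mxE !exprMn !exprVn.
  case: ifPn => la; last by rewrite subr0 mulrBl; congr (_ - _); ring.
  rewrite /s -(expr_odd_norm1 n); last by apply: top_norm; rewrite /top ma la.
  by rewrite exprMn exprVn sub0r mulrBl addrAC; ring.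
have rest_cvg j : rest n j @[n --> \oo] --> 0.
  under eq_fun do rewrite restE.
  have mu0 : rho^-1 ^+ n * (m ord_max)^R 0 j @[n --> \oo] --> 0.
    by apply: cvg_geometric0; rewrite normfV gtr0_norm// invf_lt1.
  apply: cvg0D mu0; apply: cvg_sum0 => a ma; apply: cvg0D; last first.
    under eq_fun do rewrite -mulrN.
    apply: cvg_geometric0; rewrite normrM !normfV (gtr0_norm rho0).
    by rewrite mulr_ilt1 ?invr_ge0 ?(ltW rho0) ?invf_lt1// (lt_trans ltr01).
  have [la|la] := boolP (`|lam a| == rho); first exact: cvg_cst.
  apply: cvg_geometric0; rewrite normrM normfV (gtr0_norm rho0) ltr_pdivrMr// mul1r.
  by rewrite lt_neqAle la lam_max.
have : \forall n \near \oo, forall bj : bool * 'I_2, lead bj.1 0 bj.2 != 0 ->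
    `|rest n bj.2| < `|lead bj.1 0 bj.2|.
  apply: filter_forall => -[b j] /=.
  have [->|l0] := eqVneq (lead b 0 j) 0; first exact: nearW.
  have := rest_cvg j => /cvgrPdist_lt /(_ `|lead b 0 j|).
  rewrite normr_gt0 => /(_ l0); apply: filterS => n.
  by rewrite sub0r normrN.
apply: filterS => n hn; apply/eqP => tot0.
have /rV0Pn[j lj] := lead0 (odd n).
have := hn (odd n, j) lj; rewrite /= /rest.
by rewrite (_ : total n = 0)// map_mx0 mxE mul0r sub0r normrN ltxx.
Qed.

Lemma independent_no_relation k (T : 'I_k -> 'M[int]_2) d
    (mk : 'I_k -> 'rV[int]_2) (m0 : 'rV[int]_2) : (0 < d)%N ->
  asymptotically_independent (with_identity (fun i n => T i ^+ n)) ->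
  (forall n, \sum_(i < k) mk i *m T i ^+ (d * n) + m0 = 0) -> forall i, mk i = 0.
Proof.
move=> d0 indep rel i; apply/eqP; apply: contraT => mi0.
pose m j := if unlift ord_max j is Some a then mk a else m0.
have mE a : m (widen_ord (leqnSn k) a) = mk a by rewrite /m widen_ord_max liftK.
have [N _ hN] : \forall n \near \oo,
    \sum_(j < k.+1) m j *m with_identity (fun i n => T i ^+ n) j n != 0.
  by apply: indep; exists (widen_ord (leqnSn k) i); rewrite mE.
have := hN (d * N)%N (leq_pmull _ d0); rewrite /= sum_with_identity.
rewrite {2}/m unlift_none.
under eq_bigr do rewrite mE.
by rewrite rel eqxx.
Qed.

(** The eigenvalues of T are roots of unity of order dividing 12: tr T takes one
    of the five values -2, ..., 2 and det (T^12 - 1) = 2 - tr (T^12) = 0 in each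
    case. *)
Lemma finite_order_vector (T : 'M[int]_2) : \det T = 1 -> `|\tr T| <= 2 ->
  exists2 v : 'rV[int]_2, v != 0 & forall n, v *m T ^+ (12 * n) = v.
Proof.
move=> T1 t2.
have T121 : \det (T ^+ 12 - 1%:M) = 0.
  have d n : \det (T ^+ n) = 1 by rewrite detX T1 expr1n.
  rewrite det_sub1; last exact: d.
  rewrite (_ : 12%N = (2 * 2 * 3)%N)// !exprM.
  rewrite mxtrace_cube; last by rewrite !detX T1 !expr1n.
  rewrite mxtrace_sqr; last exact: d.
  rewrite mxtrace_sqr//.
  have : [|| \tr T == -2, \tr T == -1, \tr T == 0, \tr T == 1 | \tr T == 2].
    by move: t2; move: (\tr T) => t; rewrite ler_norml; lia.
  by move=> /or4P[/eqP->|/eqP->|/eqP->|/orP[/eqP->|/eqP->]].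
have /det0P[v v0 vT] : \det (T ^+ 12 - 1%:M) == 0 by rewrite T121.
have {}vT : v *m T ^+ 12 = v.
  by apply/eqP; rewrite -subr_eq0 -[X in _ - X]mulmx1 -mulmxBr vT.
exists v => //; elim=> [|n IH]; first by rewrite muln0 mulmx1.
by rewrite mulnS exprD -mulmxE mulmxA vT.
Qed.

(** The recursion of Cayley-Hamilton involves A only through tau, so the same
    coefficients serve several matrices at once. *)
Lemma power_common_recursion (tau : int) n : exists a b : int, forall A : 'M[int]_2,
  A *m A = tau *: A - 1%:M -> A ^+ n = a *: A + b%:M.
Proof.
elim: n => [|n [a [b IH]]]; first by exists 0, 1 => A _; rewrite scale0r add0r.
exists (a * tau + b), (- a) => A AA.
rewrite exprSr IH// -mulmxE mulmxDl -scalemxAl AA mul_scalar_mx scalerBr scalerA.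
by rewrite scalerDl addrAC scalemx1 raddfN.
Qed.

(** The equation amounts to two scalar equations in four unknowns; completed by
    two zero columns, it is a singular square system. *)
Lemma int_relation (B C : 'M[int]_2) : exists p q : 'rV[int]_2,
  p *m B + q *m C = 0 /\ (p != 0 \/ q != 0).
Proof.
have /det0P[v v0] : \det (block_mx B 0 C 0 : 'M[int]_(2 + 2)) == 0.
  rewrite -det_tr tr_block_mx !trmx0.
  apply/eqP; rewrite (expand_det_row _ (rshift 2 ord0)) big1// => j _.
  by rewrite /block_mx col_mxEd row_mx0 mxE mul0r.
rewrite -[v]hsubmxK mul_row_block !mulmx0 addr0 => h.
exists (lsubmx v), (rsubmx v); split.
  by have := congr1 lsubmx h; rewrite row_mxKl linear0.
apply/orP; rewrite -negb_and; apply: contraNN v0 => /andP[/eqP l0 /eqP r0].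
by rewrite -[v]hsubmxK l0 r0 row_mx0.
Qed.

Lemma conditions_of_independent k (T : 'I_k -> 'M[int]_2) :
  (forall i, \det (T i) = 1) ->
  asymptotically_independent (with_identity (fun i n => T i ^+ n)) ->
  [/\ forall i, hyperbolic R (T i),
      forall i j, i != j -> T i <> T j /\ T i <> - T j
    & forall rho : R, 1 < rho ->
        (#|[pred i : 'I_k | `[< has_eigenvalue_of_modulus rho (T i) >]]| <= 2)%N].
Proof.
move=> T1 indep.
have e0 : exists v : 'rV[int]_2, v != 0.
  by exists (delta_mx 0 0); apply/rV0Pn; exists 0; rewrite !mxE.
split.
- move=> i; apply: contrapT => /(not_hyperbolic_trace (T1 i)).
  move=> /(finite_order_vector (T1 i))[v v0 vT].
  pose mk j := if j == i then v else 0.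
  have mk_i : mk i = 0.
    apply: (@independent_no_relation k T 12 mk (- v)) => // n.
    rewrite (bigD1 i)//= big1 ?addr0; last first.
      by move=> j /negbTE ji; rewrite /mk ji mul0mx.
    by rewrite /mk eqxx vT subrr.
  by move: mk_i v0; rewrite /mk eqxx => ->; rewrite eqxx.
- move=> i j ij.
  (* If the squares agree, v and - v give a relation at every even n. *)
  suff h : ~ (T i ^+ 2 = T j ^+ 2).
    by split=> Tij; apply: h; rewrite Tij ?sqrrN.
  move=> T2; have [v v0] := e0.
  pose mk l := if l == i then v else if l == j then - v else 0.
  have mk_i : mk i = 0.
    apply: (@independent_no_relation k T 2 mk 0) => // n.
    rewrite addr0 (bigD1 i)//= (bigD1 j)//=; last by rewrite eq_sym.
    rewrite big1 ?addr0; last first.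
      by move=> l /andP[/negbTE li /negbTE lj]; rewrite /mk li lj mul0mx.
    by rewrite /mk eqxx [j == i]eq_sym (negbTE ij) eqxx !exprM T2 mulNmx subrr.
  by move: mk_i v0; rewrite /mk eqxx => ->; rewrite eqxx.
- move=> rho r1; rewrite leqNgt; apply/negP => /card_gt2P[i1 [i2 [i3]]].
  rewrite !mem_asbool_pred => -[[/asboolP h1 /asboolP h2 /asboolP h3] [i12 i23 i31]].
  have tr2 i j : has_eigenvalue_of_modulus rho (T i) ->
      has_eigenvalue_of_modulus rho (T j) -> \tr (T i) ^+ 2 = \tr (T j) ^+ 2.
    move=> hi hj; apply/eqP; rewrite -(eqr_int R) !rmorphXn /=.
    by rewrite !(modulus_trace _ r1)// T1.
  pose tau := \tr (T i1) ^+ 2 - 2.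
  (* The trace of the square is determined by rho, so the three squares satisfy
     the same quadratic equation. *)
  have sqT i : has_eigenvalue_of_modulus rho (T i) ->
      T i ^+ 2 *m T i ^+ 2 = tau *: T i ^+ 2 - 1%:M.
    move=> hi; rewrite mulmx_det1 ?detX ?T1 ?expr1n// mxtrace_sqr ?T1//.
    by rewrite (tr2 _ _ hi h1).
  have [p [q [pq0 pq]]] := int_relation (T i1 ^+ 2 - T i3 ^+ 2) (T i2 ^+ 2 - T i3 ^+ 2).
  (* The vectors sum to zero, and so do their images under the squares. *)
  pose mk l := if l == i1 then p else if l == i2 then q else
    if l == i3 then - (p + q) else 0.
  have mk0 : forall i, mk i = 0.
    apply: (@independent_no_relation k T 2 mk 0) => // n.
    rewrite addr0 (bigD1 i1)//= (bigD1 i2)//=; last by rewrite eq_sym.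
    rewrite (bigD1 i3)//=; last by rewrite i31 eq_sym i23.
    rewrite big1 ?addr0; last first.
      by move=> l /andP[/andP[/negbTE l1 /negbTE l2] /negbTE l3]; rewrite /mk l1 l2 l3 mul0mx.
    have -> : mk i1 = p by rewrite /mk eqxx.
    have -> : mk i2 = q by rewrite /mk [i2 == _]eq_sym (negbTE i12) eqxx.
    have -> : mk i3 = - (p + q).
      by rewrite /mk (negbTE i31) [i3 == _]eq_sym (negbTE i23) eqxx.
    rewrite !exprM; have [a [b ab]] := power_common_recursion tau n.
    rewrite !ab ?sqT//; set A1 := T i1 ^+ 2; set A2 := T i2 ^+ 2; set A3 := T i3 ^+ 2.
    rewrite -/A1 -/A2 -/A3 in pq0.
    have diff (A B : 'M[int]_2) : a *: A + b%:M - (a *: B + b%:M) = a *: (A - B).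
      by rewrite opprD addrACA subrr addr0 -scalerBr.
    set X1 := _ + b%:M; set X2 := _ + b%:M; set X3 := _ + b%:M.
    have -> : p *m X1 + (q *m X2 + - (p + q) *m X3) = p *m (X1 - X3) + q *m (X2 - X3).
      by rewrite !mulmxBr mulNmx mulmxDl opprD addrACA !addrA.
    by rewrite /X1 /X2 /X3 !diff -!scalemxAr -scalerDr pq0 scaler0.
  case: pq => [p0|q0].
    by have := mk0 i1; rewrite /mk eqxx => p00; rewrite p00 eqxx in p0.
  have := mk0 i2; rewrite /mk [i2 == _]eq_sym (negbTE i12) eqxx => q00.
  by rewrite q00 eqxx in q0.
Qed.

End arithmetic.

Local Open Scope ring_scope.
Theorem proposition2p10 (R : realType) (k : nat) (T : 'I_k -> 'M[int]_2)
    (hk : (1 <= k)%N) (hT : forall i, \det (T i) = 1) :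
  jointly_mixing R T <->
  [/\ forall i, hyperbolic R (T i),
      forall i j, i != j -> T i <> T j /\ T i <> - T j
    & forall rho : R, 1 < rho ->
        (#|[pred i : 'I_k | `[< has_eigenvalue_of_modulus rho (T i) >]]| <= 2)%N].
Proof.
have detT i n : \det (T i ^+ n) = 1 by rewrite detX hT expr1n.
rewrite /jointly_mixing jointly_mixing_seqP//; split.
  exact: conditions_of_independent.
by move=> [hyp neqT card2]; exact: asymptotically_independent_powers.
Qed.
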